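(* Let $\Omega\subset\mathbb{C}$ be a domain and $V\subset\Omega$ an open set such that for every $\alpha\in\overline{V}\cap\partial\Omega$ there exists $\beta\in\Omega^c$, $\beta\neq\alpha$, such that $[\alpha,\beta]\subseteq\Omega^c$. Then the set $\{f\in X(\Omega,V): f' \text{ is totally unbounded}\}$ is dense and $G_\delta$ in $X(\Omega,V)$. Furthermore, the set of non-extendable functions in $X(\Omega,V)$ is a $G_\delta$ and dense subset of $X(\Omega,V)$.
   Context: A domain is a nonempty connected open set; $\Omega^c=\mathbb{C}\smallsetminus\Omega$; $[\alpha,\beta]$ is the closed line segment; closures and boundaries are taken in $\mathbb{C}$. $H(\Omega)$ is the set of holomorphic functions on $\Omega$ and $$X(\Omega,V)=\{f\in H(\Omega): f|_V \text{ is bounded}\},$$ endowed with the Fréchet topology induced by the seminorms $\sup_{z\in V}|f(z)|$ and $\sup_{z\in K_m}|f(z)|$, $m=1,2,\dots$, where $\{K_m\}_{m=1}^\infty$ is an exhaustive sequence of compact subsets of $\Omega$. A function $g:\Omega\to\mathbb{C}$ is called totally unbounded (on $\Omega$) if for every open disc $B(\zeta,\varepsilon)$ with $\varepsilon>0$ and $\zeta\in\partial\Omega$ and every connected component $Y$ of $B(\zeta,\varepsilon)\cap\Omega$ the restriction $g|_Y$ is unbounded. A holomorphic function $f$ on $\Omega$ is called extendable if there exist a domain $U\subset\mathbb{C}$ with $\partial\Omega\cap U\neq\emptyset$ and a holomorphic function $F$ on $U$ such that $f|_Y=F|_Y$ for some connected component $Y$ of $U\cap\Omega$. Otherwise $f$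 is called non-extendable. *)

(* Defs.v *)
From HB Require Import structures.
From mathcomp Require Import all_boot all_order all_algebra.
From mathcomp Require Import complex.
From mathcomp Require Import all_classical all_reals all_analysis.

Set Implicit Arguments.
Unset Strict Implicit.
Unset Printing Implicit Defensive.

Import Order.TTheory GRing.Theory Num.Theory.
Import numFieldNormedType.Exports.

Local Open Scope classical_set_scope.
Local Open Scope complex_scope.
Local Open Scope ring_scope.

(* The complex plane is written [R[i]^o]: the [^o] selects the topology and    *)
(* the normed module structure of the normed field [R[i]] over itself, so that *)
(* [derivable f z 1] is complex differentiability at [z] and [derive1 f] is    *)
(* the complex derivative of [f].                                              *)

Section planar_sets.
Context {R : realType}.
Implicit Types (A Y : set R[i]^o) (a b : R[i]^o).

Definition domain A := [/\ open A, A !=set0 & connected A].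

Definition boundary A : set R[i]^o := closure A `\` A^°.

Definition segment a b : set R[i]^o :=
  [set (1 - t)%:C * a + t%:C * b | t in `[0, 1]%classic].

Definition is_component Y A := exists2 x, A x & Y = connected_component A x.

Definition exhaustion A (K : (set R[i]^o)^nat) :=
  [/\ forall m, compact (K m), forall m, K m `<=` (K m.+1)^°
    & \bigcup_m K m = A].

End planar_sets.

Section functions.
Context {R : realType}.
Implicit Types (Omega U Y : set R[i]^o) (f g : R[i]^o -> R[i]^o).

(* Only used on open sets. *)
Definition holomorphic_on Omega f := forall z, Omega z -> derivable f z 1.

Definition totally_unbounded Omega g :=
  forall (zeta : R[i]^o) (e : R), boundary Omega zeta -> 0 < e ->
  forall Y, is_component Y (ball zeta e%:C `&` Omega) ->
    ~ [bounded g z | z in Y].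

Definition extendable Omega f :=
  exists (U : set R[i]^o) (F : R[i]^o -> R[i]^o) (Y : set R[i]^o),
    [/\ domain U, boundary Omega `&` U !=set0, holomorphic_on U F,
        is_component Y (U `&` Omega) & forall z, Y z -> f z = F z].

(* The supremum over the empty set is 0. *)
Definition supnorm (A : set R[i]^o) f : R :=
  sup [set complex.Re `|f z| | z in A].

End functions.

(* A function on [Omega] is represented by its extension by 0 to the plane, so *)
(* that equality in [X Omega V K] is equality on [Omega]. The exhaustion [K]   *)
(* is a parameter because the topology is defined from it.                     *)
Record X (R : realType) (Omega V : set R[i]^o) (K : (set R[i]^o)^nat) := MkX {
  X_fun :> R[i]^o -> R[i]^o ;
  X_holomorphic : holomorphic_on Omega X_fun ;
  X_bounded : [bounded X_fun z | z in V] ;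
  X_out : forall z, ~ Omega z -> X_fun z = 0 }.

Section frechet_topology.
Context {R : realType} (Omega V : set R[i]^o) (K : (set R[i]^o)^nat).
Local Notation X := (X Omega V K).

HB.instance Definition _ := gen_eqMixin X.
HB.instance Definition _ := gen_choiceMixin X.

Definition X_seminorm (i : option nat) (f : R[i]^o -> R[i]^o) : R :=
  if i is Some m then supnorm (K m) f else supnorm V f.

Lemma holomorphic_on_zero : holomorphic_on Omega (fun=> 0).
Proof. by move=> z _; exact: derivable_cst. Qed.

Lemma bounded_zero : [bounded (0 : R[i]^o) | z in V].
Proof. exact: bounded_cst. Qed.

Definition X_zero : X :=
  @MkX R Omega V K (fun=> 0) holomorphic_on_zero bounded_zero (fun _ _ => erefl).

HB.instance Definition _ := isPointed.Build X X_zero.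

(* The topology induced by the seminorms: the open seminorm balls, indexed by  *)
(* the seminorm, the centre and the radius, form a subbase.                    *)
Definition X_ball (j : option nat * X * R) : set X :=
  [set h : X | X_seminorm j.1.1 (fun z => h z - j.1.2 z) < j.2].

HB.instance Definition _ := @isSubBaseTopological.Build X
  (option nat * X * R)%type [set j | 0 < j.2] X_ball.

End frechet_topology.

(* Main.v *)
(** A family of holomorphic functions bounded by [M] on a disk satisfies
    a second-order Taylor estimate at the centre whose constant depends only on
    [M] and the radius.  It comes from Goursat's theorem on rectangles, applied
    to difference quotients, with finitely many points where only continuity is
    known; no power series is needed.  The estimate passes to pointwise limits
    along an ultrafilter, which gives at once the completeness of [X Omega V K],
    hence Baire's theorem, and the compactness usually taken from Montel.

    Both sets of the theorem are governed by the countably many rational disks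
    centred in [Omega] and not contained in it, because every component of
    [U n Omega], for [U] a domain meeting the boundary, accumulates at a boundary
    point in [U].  The derivative is totally unbounded iff, for every such disk and
    every [n], it exceeds [n] on the component of the centre: an open condition,
    dense since it can be forced by adding a small multiple of one function whose
    derivative blows up at a given boundary point [a].  That function is
    [1/(z - a)] if [a] is not in the closure of [V], and otherwise
    [1/(1 + sqrt((z - a)/(z - b)))] with [b] the other end of the segment: the
    square root has positive real part off [[a, b]], so the function is bounded
    by 1.  Extendability is a countable union, over the disks and [n], of the
    condition that the function extends from the component of the centre to the
    disk with bound [n], which is closed by the compactness above. *)

Require Import Defs.
From mathcomp Require Import all_boot all_order all_algebra.
From mathcomp Require Import complex.
From mathcomp Require Import all_classical all_reals all_analysis.
From mathcomp Require Import borel_hierarchy.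
From mathcomp Require Import ring lra.
From mathcomp Require finmap.
Import Order.TTheory GRing.Theory Num.Theory.
Import numFieldNormedType.Exports.
Import Normc.
Local Open Scope classical_set_scope.
Local Open Scope complex_scope.
Local Open Scope ring_scope.

(** * The complex plane and complex derivatives *)

Section modulus.
Context {R : realType}.
Implicit Types (z w : R[i]) (e : R).

Lemma normrcE z : `|z| = (normc z)%:C :> R[i]. Proof. by []. Qed.

Lemma normc_ge0 z : 0 <= normc z.
Proof. by case: z => a b; rewrite sqrtr_ge0. Qed.

Lemma normc_gt0 z : z != 0 -> 0 < normc z.
Proof.
move=> z0; rewrite lt_def normc_ge0 andbT; apply: contra z0 => /eqP.
by move/eq0_normc => ->.
Qed.

Lemma normcB z w : normc (z - w) = normc (w - z).
Proof. by rewrite -opprB normcN. Qed.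

Lemma normcD z w : normc (z + w) <= normc z + normc w.
Proof. exact: le_normcD. Qed.

Lemma normc_real (x : R) : normc x%:C = `|x|.
Proof. by rewrite /= expr0n /= addr0 sqrtr_sqr. Qed.

Lemma normc_Re z : `|complex.Re z| <= normc z.
Proof. by rewrite -lecR -normrcE; exact: normc_ge_Re. Qed.

Lemma normc_Im z : `|complex.Im z| <= normc z.
Proof.
case: z => a b /=; rewrite -sqrtr_sqr ler_wsqrtr //.
by rewrite lerDr sqr_ge0.
Qed.

Lemma normc_ReIm z : normc z <= `|complex.Re z| + `|complex.Im z|.
Proof.
rewrite {1}(complexE z); apply: le_trans (normcD _ _) _.
by rewrite normcM !normc_real /= expr0n expr1n add0r sqrtr1 mul1r.
Qed.

Lemma normc_triangle z1 z2 z3 :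
  normc (z1 - z3) <= normc (z1 - z2) + normc (z2 - z3).
Proof. by rewrite -[z1 - z3](subrKA z2); exact: normcD. Qed.

Lemma normc_le_near z w : normc z <= normc (w - z) + normc w.
Proof. by rewrite (normcB w); have := normcD (z - w) w; rewrite subrK. Qed.

End modulus.

Section planar_topology.
Context {R : realType}.
Implicit Types (z w : R[i]^o) (A : set R[i]^o) (f : R[i]^o -> R[i]^o).

Lemma ball_normcE z (e : R) w : ball z e%:C w = (normc (w - z) < e) :> Prop.
Proof.
by rewrite -ball_normE /ball_ /= normrcE ltcR normcB.
Qed.

(** Radii of balls in [R[i]^o] live in [R[i]], where a positive element is a positive real.
    Neighbourhoods can therefore be described with real radii throughout. *)
Lemma ball_cplx (e : R[i]) : 0 < e -> exists2 d : R, 0 < d & e = d%:C.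
Proof.
case: e => a b; rewrite ltcE /= => /andP[/eqP -> a0]; by exists a.
Qed.

Lemma nbhs_normcP z A :
  nbhs z A <-> exists2 e : R, 0 < e & forall w, normc (w - z) < e -> A w.
Proof.
split.
  move=> /nbhs_ballP[e /= e0]; have [d d0 ->] := ball_cplx e e0.
  by move=> h; exists d => // w; rewrite -ball_normcE; exact: h.
move=> [e e0 h]; apply/nbhs_ballP; exists e%:C => /=; first by rewrite ltcR.
by move=> w; rewrite ball_normcE; exact: h.
Qed.

Lemma open_normcP A : open A <->
  forall z, A z -> exists2 e : R, 0 < e & forall w, normc (w - z) < e -> A w.
Proof.
by rewrite openE; split => h z /h /nbhs_normcP.
Qed.

Lemma open_ballc z (e : R) : open (ball z e%:C).
Proof.
apply/open_normcP => w; rewrite ball_normcE => h.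
exists (e - normc (w - z)); first by rewrite subr_gt0.
move=> v; rewrite ball_normcE => hv.
by apply: le_lt_trans (normc_triangle _ w _) _; rewrite -ltrBrDr.
Qed.

Lemma closure_normcP A z :
  closure A z <-> forall e : R, 0 < e -> exists2 w, A w & normc (w - z) < e.
Proof.
split=> [h e e0|h B /nbhs_normcP[e e0 eB]].
  have /h[w [Aw Bw]] : nbhs z (ball z e%:C).
    by apply/nbhs_normcP; exists e => // w; rewrite ball_normcE.
  by exists w => //; rewrite -ball_normcE.
have [w Aw wz] := h e e0; by exists w; split => //; exact: eB.
Qed.

Lemma bounded_normcP A f :
  [bounded f z | z in A] <-> exists M : R, forall z, A z -> normc (f z) <= M.
Proof.
split.
  move=> [M [Mr hM]]; exists (complex.Re M + 1) => z Az.
  have h : M < (complex.Re M + 1)%:C.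
    by rewrite -{1}(RRe_real Mr) ltcR ltrDl.
  by move: (hM _ h z Az); rewrite /= normrcE lecR.
move=> [M hM]; exists M%:C; split; first by apply/complex_realP; exists M.
move=> x Mx z Az /=; rewrite normrcE.
by apply: le_trans (ltW Mx); rewrite lecR hM.
Qed.

End planar_topology.

Section complex_derivative.
Context {R : realType}.
Implicit Types (f : R[i]^o -> R[i]^o) (z d : R[i]^o).

Definition ccont f z := forall e : R, 0 < e -> exists2 r : R, 0 < r &
  forall w, normc (w - z) < r -> normc (f w - f z) < e.

(** The remainder is compared without division, so [w = z] is allowed and needs no separate
    treatment. *)
Definition is_cderive f z d := forall e : R, 0 < e -> exists2 r : R, 0 < r &
  forall w, normc (w - z) < r ->
    normc (f w - f z - d * (w - z)) <= e * normc (w - z).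

Lemma is_cderiveE f z d : is_cderive f z d ->
  derivable f z 1 /\ derive1 f z = d.
Proof.
move=> h.
have H : (fun k : R[i]^o => k^-1 *: (f (k + z) - f z)) @ 0^' --> d.
  apply/cvgrPdist_lt => _ /ball_cplx[e e0 ->].
  have e20 : 0 < e / 2 by rewrite divr_gt0.
  have [r r0 hr] := h _ e20.
  rewrite near_withinE; apply/nbhs_normcP; exists r => // k; rewrite subr0 => kr k0.
  rewrite normrcE ltcR normcB.
  have := hr (k + z); rewrite addrK => /(_ kr) {}hr.
  have -> : (k^-1 *: (f (k + z) - f z) : R[i]^o) - d = k^-1 * (f (k + z) - f z - d * k).
    by rewrite mulrBr mulrCA mulVf // mulr1.
  rewrite normcM normcV mulrC ltr_pdivrMr ?normc_gt0 //.
  apply: le_lt_trans hr _; rewrite ltr_pM2r ?normc_gt0 //.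
  by rewrite ltr_pdivrMr // ltr_pMr // ltr1n.
split; last exact: cvg_lim H.
rewrite /derivable.
have -> : (fun h0 : R[i]^o => h0^-1 *: (f (h0 *: (1:R[i]^o) + z) - f z)) = (fun k : R[i]^o => k^-1 *: (f (k + z) - f z)).
  by apply/funext => k; rewrite /GRing.scale /= mulr1.
by apply: cvgP H.
Qed.

Lemma derivable_cderive f z : derivable f z 1 -> is_cderive f z (derive1 f z).
Proof.
move=> df.
have H : (fun k : R[i]^o => k^-1 *: (f (k + z) - f z)) @ 0^' --> derive1 f z.
  move: df; rewrite /derivable /derive1.
  have -> : (fun h0 : R[i]^o => h0^-1 *: (f (h0 *: (1:R[i]^o) + z) - f z)) = (fun k : R[i]^o => k^-1 *: (f (k + z) - f z)).
    by apply/funext => k; rewrite /GRing.scale /= mulr1.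
  by [].
move=> e e0.
have e0' : 0 < e%:C :> R[i] by rewrite ltcR.
move/cvgrPdist_lt: H => /(_ _ e0'); rewrite near_withinE => /nbhs_normcP[r r0 hr].
exists r => // w wr.
have [->|wz] := eqVneq w z.
  by rewrite !subrr mulr0 subrr normc0 mulr0.
have k0 : w - z != 0 by rewrite subr_eq0.
have := hr (w - z); rewrite subr0 => /(_ wr k0) /=.
rewrite subrK normrcE ltcR normcB => /ltW h.
have -> : f w - f z - f^`()%classic z * (w - z) =
   ((w - z)^-1 *: (f w - f z) - f^`()%classic z) * (w - z).
  by rewrite mulrBl /GRing.scale /= mulrAC mulVf // mul1r.
by rewrite normcM ler_wpM2r // normc_ge0.
Qed.

Lemma is_cderive_unique f z d d' : is_cderive f z d -> is_cderive f z d' ->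
  d = d'.
Proof. by move=> /is_cderiveE[_ <-] /is_cderiveE[_ <-]. Qed.

Lemma is_cderive_ccont f z d : is_cderive f z d -> ccont f z.
Proof.
move=> h e e0.
have [r r0 hr] := h 1 ltr01.
have B0 : 0 < 1 + normc d by rewrite ltr_pwDl // normc_ge0.
exists (Num.min r (e / (1 + normc d))).
  by rewrite lt_min r0 divr_gt0.
move=> w; rewrite lt_min => /andP[/hr h1]; rewrite ltr_pdivlMr // => h2.
apply: le_lt_trans h2.
rewrite -[f w - f z](subrK (d * (w - z))) [normc _ * (1 + _)]mulrDr mulr1.
apply: le_trans (normcD _ _) _; rewrite normcM.
by rewrite lerD //; [rewrite mul1r in h1|rewrite mulrC].
Qed.

End complex_derivative.

(** * Integrals over rectangles and Goursat's theorem *)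

Section path_integral.
Context {R : realType}.
Notation mu := (@lebesgue_measure R).
Implicit Types (p q : R -> R[i]) (a b : R).

Definition pcont p (x : R) := forall e : R, 0 < e -> exists2 d : R, 0 < d &
  forall y, `|y - x| < d -> normc (p y - p x) < e.

Definition pcont_on a b p := forall x, a <= x <= b -> pcont p x.

(** Componentwise, so that linearity, splitting and bounds come from the real Lebesgue integral. The
    price is the factor 2 in [cint_bound]. *)
Definition cint a b p : R[i] :=
  (\int[mu]_(x in `[a, b]) complex.Re (p x)) +i*
  (\int[mu]_(x in `[a, b]) complex.Im (p x)).

Lemma real_itv_integrable a b (f : R -> R) :
  (forall x, a <= x <= b -> forall e, 0 < e -> exists2 d : R, 0 < d &
     forall y, `|y - x| < d -> `|f y - f x| < e) ->
  mu.-integrable `[a, b] (EFin \o f).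
Proof.
move=> h; apply: continuous_compact_integrable; first exact: segment_compact.
apply: continuous_in_subspaceT => x; rewrite inE /= in_itv /= => xab.
apply/cvgrPdist_lt => e e0; have [d d0 hd] := h x xab e e0.
rewrite near_simpl; apply/nbhs_ballP; exists d => //= y.
by rewrite -ball_normE /ball_ /= distrC => /hd; rewrite distrC.
Qed.

Lemma ReB (z w : R[i]) : complex.Re (z - w) = complex.Re z - complex.Re w.
Proof. by case: z; case: w. Qed.

Lemma ImB (z w : R[i]) : complex.Im (z - w) = complex.Im z - complex.Im w.
Proof. by case: z; case: w. Qed.

Lemma Re_integrable a b p : pcont_on a b p ->
  mu.-integrable `[a, b] (EFin \o (fun x => complex.Re (p x))).
Proof.
move=> h; apply: real_itv_integrable => x xab e e0.
have [d d0 hd] := h x xab e e0; exists d => // y /hd.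
by apply: le_lt_trans; rewrite -ReB; exact: normc_Re.
Qed.

Lemma Im_integrable a b p : pcont_on a b p ->
  mu.-integrable `[a, b] (EFin \o (fun x => complex.Im (p x))).
Proof.
move=> h; apply: real_itv_integrable => x xab e e0.
have [d d0 hd] := h x xab e e0; exists d => // y /hd.
by apply: le_lt_trans; rewrite -ImB; exact: normc_Im.
Qed.

Lemma eq_cint a b p q : (forall x, a <= x <= b -> p x = q x) ->
  cint a b p = cint a b q.
Proof.
move=> h; congr (_ +i* _); apply: eq_Rintegral => x;
  by rewrite inE /= in_itv /= => /h ->.
Qed.

Lemma cintB a b p q : pcont_on a b p -> pcont_on a b q ->
  cint a b (fun x => p x - q x) = cint a b p - cint a b q.
Proof.
move=> hp hq; apply/eqP; rewrite eq_complex /=; apply/andP; split; apply/eqP.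
  under eq_Rintegral do rewrite ReB.
  by rewrite RintegralB //; exact: Re_integrable.
under eq_Rintegral do rewrite ImB.
by rewrite RintegralB //; exact: Im_integrable.
Qed.

Lemma cintZ a b (c : R[i]) p : pcont_on a b p ->
  cint a b (fun x => c * p x) = c * cint a b p.
Proof.
move=> hp; have [r s] := (Re_integrable _ _ _ hp, Im_integrable _ _ _ hp).
have mab : measurable `[a, b] by [].
case: c => u v; rewrite /cint /=.
have -> : (fun x => complex.Re ((u +i* v) * p x)) =
  (fun x => u * complex.Re (p x) - v * complex.Im (p x)).
  by apply/funext => x; case: (p x).
have -> : (fun x => complex.Im ((u +i* v) * p x)) =
  (fun x => u * complex.Im (p x) + v * complex.Re (p x)).
  by apply/funext => x; case: (p x).
have hZ (k : R) (f : R -> R) : mu.-integrable `[a, b] (EFin \o f) ->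
    mu.-integrable `[a, b] (EFin \o (fun x => k * f x)).
  by move=> hf; rewrite (_ : _ \o _ = (fun x => k%:E * (f x)%:E)%E);
    [exact: integrableZl | apply/funext].
by rewrite RintegralB ?RintegralD ?RintegralZl //; try exact: hZ.
Qed.

Lemma Rint_split a m b (f : R -> R) : a <= m <= b ->
  mu.-integrable `[a, b] (EFin \o f) ->
  \int[mu]_(x in `[a, b]) f x =
  \int[mu]_(x in `[a, m]) f x + \int[mu]_(x in `[m, b]) f x.
Proof.
move=> /andP[am mb] hf.
rewrite -[X in _ + X]Rintegral_itv_obnd_cbnd; last first.
  apply: integrableS hf => //; apply: subset_itv; rewrite ?bnd_simp //.
rewrite -(@Rintegral_itvB _ _ (BLeft a) (BRight b) m hf) ?bnd_simp //.
by rewrite addrC subrK.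
Qed.

Lemma cint_split a m b p : a <= m <= b -> pcont_on a b p ->
  cint a b p = cint a m p + cint m b p.
Proof.
move=> amb hp; rewrite /cint (Rint_split a m b) //; last exact: Re_integrable.
by rewrite [X in _ +i* X](Rint_split a m b) //; exact: Im_integrable.
Qed.

Lemma cint_cst a b (c : R[i]) : a <= b -> cint a b (fun=> c) = (b - a)%:C * c.
Proof.
move=> ab; rewrite /cint !Rintegral_cst //= lebesgue_measure_itv /= lte_fin.
case: c => u v.
have -> : fine (if (a < b)%R then b%:E - a%:E else 0)%E = b - a.
  by case: ltP => //= ba; rewrite (@le_anti _ _ a b) ?ab ?ba // subrr.
by rewrite /=; congr (_ +i* _); ring.
Qed.

Lemma cintxx a p : cint a a p = 0.
Proof. by rewrite /cint set_itv1 !Rintegral_set1. Qed.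

Lemma Rint_bound a b (f : R -> R) (M : R) : a <= b ->
  mu.-integrable `[a, b] (EFin \o f) -> (forall x, a <= x <= b -> `|f x| <= M) ->
  `|\int[mu]_(x in `[a, b]) f x| <= M * (b - a).
Proof.
move=> ab hf hM; apply: le_trans (le_normr_Rintegral _ hf) _ => //.
have := cint_cst a b M%:C ab; rewrite /cint => /(congr1 (@complex.Re R)) /=.
rewrite mul0r subr0 mulrC => <-.
apply: le_Rintegral => //.
- exact: (integrable_norm hf).
- apply: real_itv_integrable => x _ e e0; exists 1 => // y _.
  by rewrite subrr normr0.
Qed.

Lemma cint_bound a b p (M : R) : a <= b -> pcont_on a b p ->
  (forall x, a <= x <= b -> normc (p x) <= M) ->
  normc (cint a b p) <= 2 * M * (b - a).
Proof.
move=> ab hp hM; apply: le_trans (normc_ReIm _) _.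
rewrite /= mulrAC mulr2n mulrDl mul1r mulrDl (mulrC (b - a)).
apply: lerD; apply: Rint_bound => //;
  [exact: Re_integrable| |exact: Im_integrable|] => x /hM; apply: le_trans.
  exact: normc_Re.
exact: normc_Im.
Qed.

(** Serves the kernel integral in [square_rint_kernel], to which each of the four sides contributes
    a positive imaginary part. *)
Lemma cint_Im_ge a b p (m : R) : a <= b -> pcont_on a b p ->
  (forall x, a <= x <= b -> m <= complex.Im (p x)) ->
  m * (b - a) <= complex.Im (cint a b p).
Proof.
move=> ab hp hm.
have := cint_cst a b m%:C ab; rewrite /cint => /(congr1 (@complex.Re R)) /=.
rewrite mul0r subr0 mulrC => <-.
apply: le_Rintegral => //.
- apply: real_itv_integrable => x _ e e0; exists 1 => // y _.
  by rewrite subrr normr0.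
- exact: Im_integrable.
Qed.

End path_integral.

(** * Continuity and the rules of complex differentiation *)

Section complex_continuity.
Context {R : realType}.
Implicit Types (g h : R[i]^o -> R[i]^o) (z w c d : R[i]^o).

Lemma ccontB g h z : ccont g z -> ccont h z -> ccont (fun w => g w - h w) z.
Proof.
move=> hg hh e e0; have e2 : 0 < e / 2 by rewrite divr_gt0.
have [r r0 hr] := hg _ e2; have [s s0 hs] := hh _ e2.
exists (Num.min r s); first by rewrite lt_min r0.
move=> w; rewrite lt_min => /andP[/hr k1 /hs k2].
have -> : g w - h w - (g z - h z) = (g w - g z) - (h w - h z) by ring.
apply: le_lt_trans (normcD _ _) _; rewrite normcN [e]splitr; exact: ltrD.
Qed.

Lemma ccont_cst c z : ccont (fun=> c) z.
Proof. by move=> e e0; exists 1 => // w _; rewrite subrr normc0. Qed.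

Lemma ccont_id z : ccont id z.
Proof. by move=> e e0; exists e. Qed.

Lemma ccontM g h z : ccont g z -> ccont h z -> ccont (fun w => g w * h w) z.
Proof.
move=> hg hh e e0.
have a0 : 0 < normc (h z) + 1 by rewrite ltr_wpDl ?normc_ge0.
have b0 : 0 < normc (g z) + 1 by rewrite ltr_wpDl ?normc_ge0.
have [r1 r10 h1] := hg (e / 2 / (normc (h z) + 1)) ltac:(by rewrite !divr_gt0).
have [r2 r20 h2] := hh (e / 2 / (normc (g z) + 1)) ltac:(by rewrite !divr_gt0).
have [r3 r30 h3] := hh 1 ltr01.
exists (Num.min r1 (Num.min r2 r3)); first by rewrite !lt_min r10 r20.
move=> w; rewrite !lt_min => /and3P[/h1 k1 /h2 k2 /h3 k3].
have -> : g w * h w - g z * h z = (g w - g z) * h w + (h w - h z) * g z by ring.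
apply: le_lt_trans (normcD _ _) _; rewrite !normcM.
have hw : normc (h w) <= normc (h z) + 1.
  by have := normcD (h w - h z) (h z); rewrite subrK; move: k3; lra.
move: k1 k2; rewrite !ltr_pdivlMr // => k1 k2.
have := ler_wpM2l (normc_ge0 (g w - g z)) hw.
have : normc (h w - h z) * normc (g z) <= normc (h w - h z) * (normc (g z) + 1).
  by apply: ler_wpM2l; rewrite ?normc_ge0 // lerDl.
lra.
Qed.

Lemma ccontV g z : g z != 0 -> ccont g z -> ccont (fun w => (g w)^-1) z.
Proof.
move=> g0 hg e e0; have n0 := normc_gt0 _ g0.
set N := normc (g z) in n0 *.
have [r1 r10 h1] := hg (N / 2) ltac:(by rewrite divr_gt0).
have [r2 r20 h2] := hg (e * (N / 2 * N)) ltac:(by rewrite !(mulr_gt0, divr_gt0)).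
exists (Num.min r1 r2); first by rewrite !lt_min r10 r20.
move=> w; rewrite !lt_min => /andP[/h1 k1 /h2 k2].
have hw : N / 2 < normc (g w).
  have : N <= normc (g w - g z) + normc (g w).
    by have := normcD (g z - g w) (g w); rewrite subrK normcB.
  by move: k1; lra.
have gw0 : g w != 0.
  apply/eqP => E; move: hw; rewrite E normc0; apply/negP; rewrite -leNgt.
  by rewrite divr_ge0 // ltW.
have -> : (g w)^-1 - (g z)^-1 = - (g w - g z) / (g w * g z).
  by field; rewrite g0 gw0.
rewrite normcM normcN normcV normcM ltr_pdivrMr; last first.
  by rewrite mulr_gt0 // (lt_trans _ hw) // divr_gt0.
apply: lt_le_trans k2 _; rewrite -/N.
by apply: ler_wpM2l; [exact: ltW|apply: ler_wpM2r; exact: ltW].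
Qed.

Lemma ccont_near_eq g h z (r : R) : 0 < r ->
  (forall w, normc (w - z) < r -> g w = h w) -> ccont g z -> ccont h z.
Proof.
move=> r0 gh hg e /hg[s s0 hs]; exists (Num.min r s); first by rewrite lt_min r0.
by move=> w; rewrite lt_min => /andP[wr /hs]; rewrite !gh // subrr normc0.
Qed.

(* Caratheodory's form of the derivative reduces the rules of calculus to those
   for continuous functions. *)
Lemma is_cderiveP g z d : is_cderive g z d <->
  exists2 p, p z = d /\ ccont p z & exists2 r : R, 0 < r &
    forall w, normc (w - z) < r -> g w - g z = p w * (w - z).
Proof.
split.
  move=> h; exists (fun w => if w == z then d else (g w - g z) / (w - z)).
    rewrite eqxx; split => // e e0.
    have [r r0 hr] := h (e / 2) ltac:(by rewrite divr_gt0).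
    exists r => // w /hr; rewrite eqxx; case: eqP => [_ _|/eqP wz].
      by rewrite subrr normc0.
    have wz' : w - z != 0 by rewrite subr_eq0.
    have -> : g w - g z - d * (w - z) = ((g w - g z) / (w - z) - d) * (w - z).
      by field.
    rewrite normcM ler_pM2r ?normc_gt0 // => H.
    by apply: le_lt_trans H _; rewrite ltr_pdivrMr // ltr_pMr // ltr1n.
  exists 1 => // w _; case: eqP => [->|/eqP wz]; first by rewrite !subrr mulr0.
  by rewrite mulrVK // unitfE subr_eq0.
move=> [p [<- cp] [r r0 hr]] e /cp[s s0 hs].
exists (Num.min r s); first by rewrite lt_min r0.
move=> w; rewrite lt_min => /andP[/hr -> /hs h].
by rewrite -mulrBl normcM; apply: ler_wpM2r; [exact: normc_ge0|exact: ltW].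
Qed.

Lemma is_cderive_cst c z : is_cderive (fun=> c) z 0.
Proof.
by move=> e e0; exists 1 => // w _; rewrite subrr mul0r subrr normc0 mulr_ge0 ?normc_ge0 ?ltW.
Qed.

Lemma is_cderive_id z : is_cderive id z 1.
Proof.
by move=> e e0; exists 1 => // w _; rewrite mul1r subrr normc0 mulr_ge0 ?normc_ge0 ?ltW.
Qed.

Lemma is_cderiveD g h z c d : is_cderive g z c -> is_cderive h z d ->
  is_cderive (fun w => g w + h w) z (c + d).
Proof.
move=> hg hh e e0; have e2 : 0 < e / 2 by rewrite divr_gt0.
have [r r0 hr] := hg _ e2; have [s s0 hs] := hh _ e2.
exists (Num.min r s); first by rewrite lt_min r0.
move=> w; rewrite lt_min => /andP[/hr k1 /hs k2].
have -> : g w + h w - (g z + h z) - (c + d) * (w - z) =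
  (g w - g z - c * (w - z)) + (h w - h z - d * (w - z)) by ring.
apply: le_trans (normcD _ _) _; rewrite [e]splitr mulrDl; exact: lerD.
Qed.

Lemma is_cderiveM g h z c d : is_cderive g z c -> is_cderive h z d ->
  is_cderive (fun w => g w * h w) z (c * h z + g z * d).
Proof.
move=> hg hh; have ch := is_cderive_ccont _ _ _ hh.
move/is_cderiveP: hg => [p [pz cp] [r r0 hr]].
move/is_cderiveP: hh => [q [qz cq] [s s0 hs]].
apply/is_cderiveP; exists (fun w => p w * h w - (- g z) * q w).
  split; first by rewrite pz qz mulNr opprK.
  apply: ccontB; apply: ccontM => //; exact: ccont_cst.
exists (Num.min r s); first by rewrite lt_min r0.
move=> w; rewrite lt_min => /andP[/hr k1 /hs k2].
have -> : g w * h w - g z * h z = (g w - g z) * h w + g z * (h w - h z) by ring.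
by rewrite k1 k2; ring.
Qed.

Lemma is_cderiveV g z d : g z != 0 -> is_cderive g z d ->
  is_cderive (fun w => (g w)^-1) z (- d / (g z) ^+ 2).
Proof.
move=> g0 hg; have cg := is_cderive_ccont _ _ _ hg.
move/is_cderiveP: hg => [p [pz cp] [r r0 hr]].
apply/is_cderiveP; exists (fun w => p w * ((g w)^-1 * (- (g z)^-1))).
  split; first by rewrite pz; field.
  by apply: ccontM => //; apply: ccontM; [exact: ccontV|exact: ccont_cst].
have [s s0 hs] := cg (normc (g z)) (normc_gt0 _ g0).
exists (Num.min r s); first by rewrite lt_min r0.
move=> w; rewrite lt_min => /andP[/hr k1 /hs k2].
have gw0 : g w != 0.
  by apply/eqP => E; move: k2; rewrite E sub0r normcN ltxx.
have -> : p w * ((g w)^-1 * - (g z)^-1) * (w - z) =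
  - (p w * (w - z)) / (g w * g z) by field; rewrite g0 gw0.
by rewrite -k1; field; rewrite g0 gw0.
Qed.

Lemma is_cderive_near_eq g h z d (r : R) : 0 < r ->
  (forall w, normc (w - z) < r -> g w = h w) ->
  is_cderive g z d -> is_cderive h z d.
Proof.
move=> r0 gh hg e /hg[s s0 hs]; exists (Num.min r s); first by rewrite lt_min r0.
by move=> w; rewrite lt_min => /andP[wr /hs]; rewrite !gh // subrr normc0.
Qed.

End complex_continuity.

(** * Boundary integrals over rectangles *)

Section rectangle_integral.
Context {R : realType}.
Implicit Types (g h : R[i]^o -> R[i]^o) (z w c d : R[i]^o).
Implicit Types x y m : R.

Definition inrect x1 x2 y1 y2 z :=
  (x1 <= complex.Re z <= x2) && (y1 <= complex.Im z <= y2).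

Definition on_edges x1 x2 y1 y2 (P : R[i]^o -> Prop) :=
  (forall x, x1 <= x <= x2 -> P (x +i* y1) /\ P (x +i* y2)) /\
  (forall y, y1 <= y <= y2 -> P (x1 +i* y) /\ P (x2 +i* y)).

(** Counterclockwise: bottom and right edges count positively, top and left negatively, and ['i]
    comes from $dz = i\,dy$ on vertical edges. *)
Definition rint g x1 x2 y1 y2 : R[i] :=
  cint x1 x2 (fun x => g (x +i* y1)) - cint x1 x2 (fun x => g (x +i* y2)) +
  'i * (cint y1 y2 (fun y => g (x2 +i* y)) - cint y1 y2 (fun y => g (x1 +i* y))).

Lemma on_edges_rect x1 x2 y1 y2 (P : R[i]^o -> Prop) : x1 <= x2 -> y1 <= y2 ->
  (forall z, inrect x1 x2 y1 y2 z -> P z) -> on_edges x1 x2 y1 y2 P.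
Proof.
by move=> hx hy hP; split => t /= ht; split; apply: hP;
  rewrite /inrect /= ht ?lexx ?hx ?hy.
Qed.

Lemma ccont_pconth g x y : ccont g (x +i* y) ->
  pcont (fun x => g (x +i* y)) x.
Proof.
move=> h e /h[r r0 hr]; exists r => // t tx; apply: hr.
have -> : (t +i* y - x +i* y : R[i]) = (t - x)%:C.
  by rewrite /real_complex_def; congr (_ +i* _); rewrite /= subrr.
by rewrite normc_real.
Qed.

Lemma ccont_pcontv g x y : ccont g (x +i* y) ->
  pcont (fun y => g (x +i* y)) y.
Proof.
move=> h e /h[r r0 hr]; exists r => // t ty; apply: hr.
have -> : (x +i* t - x +i* y : R[i]) = 'i * (t - y)%:C.
  by rewrite /real_complex_def; apply/eqP; rewrite eq_complex /=; apply/andP; split; apply/eqP; ring.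
by rewrite normcM normc_real /= expr0n expr1n add0r sqrtr1 mul1r.
Qed.

Lemma on_edges_pcont x1 x2 y1 y2 g : on_edges x1 x2 y1 y2 (ccont g) ->
  [/\ pcont_on x1 x2 (fun x => g (x +i* y1)),
      pcont_on x1 x2 (fun x => g (x +i* y2)),
      pcont_on y1 y2 (fun y => g (x1 +i* y)) &
      pcont_on y1 y2 (fun y => g (x2 +i* y))].
Proof.
by move=> [hx hy]; split => t ht;
  [case: (hx t ht)|case: (hx t ht)|case: (hy t ht)|case: (hy t ht)] => h1 h2;
  [exact: ccont_pconth|exact: ccont_pconth|exact: ccont_pcontv|
   exact: ccont_pcontv].
Qed.

Lemma rintB x1 x2 y1 y2 g h : on_edges x1 x2 y1 y2 (ccont g) ->
  on_edges x1 x2 y1 y2 (ccont h) ->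
  rint (fun z => g z - h z) x1 x2 y1 y2 = rint g x1 x2 y1 y2 - rint h x1 x2 y1 y2.
Proof.
move=> /on_edges_pcont[g1 g2 g3 g4] /on_edges_pcont[h1 h2 h3 h4].
by rewrite /rint !cintB //; ring.
Qed.

Lemma rintZ x1 x2 y1 y2 c g : on_edges x1 x2 y1 y2 (ccont g) ->
  rint (fun z => c * g z) x1 x2 y1 y2 = c * rint g x1 x2 y1 y2.
Proof.
move=> /on_edges_pcont[g1 g2 g3 g4].
by rewrite /rint !cintZ //; ring.
Qed.

Lemma eq_rint x1 x2 y1 y2 g h : on_edges x1 x2 y1 y2 (fun z => g z = h z) ->
  rint g x1 x2 y1 y2 = rint h x1 x2 y1 y2.
Proof.
move=> [hx hy]; rewrite /rint.
by congr (_ - _ + _ * (_ - _)); apply: eq_cint => t ht;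
  [case: (hx t ht)|case: (hx t ht)|case: (hy t ht)|case: (hy t ht)].
Qed.

Lemma rint_bound x1 x2 y1 y2 g (M : R) : x1 <= x2 -> y1 <= y2 ->
  on_edges x1 x2 y1 y2 (ccont g) ->
  on_edges x1 x2 y1 y2 (fun z => normc (g z) <= M) ->
  normc (rint g x1 x2 y1 y2) <= 4 * M * ((x2 - x1) + (y2 - y1)).
Proof.
move=> hx hy /on_edges_pcont[g1 g2 g3 g4] [bx by_].
have n1 : normc (cint x1 x2 (fun x => g (x +i* y1))) <= 2 * M * (x2 - x1).
  by apply: cint_bound => // t /bx[].
have n2 : normc (cint x1 x2 (fun x => g (x +i* y2))) <= 2 * M * (x2 - x1).
  by apply: cint_bound => // t /bx[].
have n3 : normc (cint y1 y2 (fun y => g (x1 +i* y))) <= 2 * M * (y2 - y1).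
  by apply: cint_bound => // t /by_[].
have n4 : normc (cint y1 y2 (fun y => g (x2 +i* y))) <= 2 * M * (y2 - y1).
  by apply: cint_bound => // t /by_[].
apply: le_trans (normcD _ _) _.
have hi : normc ('i : R[i]) = 1 by rewrite /= expr0n expr1n add0r sqrtr1.
rewrite normcM hi mul1r.
have := normcD (cint x1 x2 (fun x => g (x +i* y1))) (- cint x1 x2 (fun x => g (x +i* y2))).
have := normcD (cint y1 y2 (fun x => g (x2 +i* x))) (- cint y1 y2 (fun x => g (x1 +i* x))).
rewrite !normcN.
lra.
Qed.

Lemma ccont_affine c d z w : ccont (fun w => c + d * (w - z)) w.
Proof.
move=> e e0; have n0 : 0 < 1 + normc d by rewrite ltr_pwDl ?normc_ge0.
exists (e / (1 + normc d)); first by rewrite divr_gt0.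
move=> v; rewrite ltr_pdivlMr // => h; apply: le_lt_trans h.
have -> : c + d * (v - z) - (c + d * (w - z)) = d * (v - w) by ring.
by rewrite normcM mulrC ler_wpM2l ?normc_ge0 // lerDr.
Qed.

(** The differences between opposite edges are the constants $i(y_1-y_2)d$ and $(x_2-x_1)d$, and
    their two contributions cancel. *)
Lemma rint_affine x1 x2 y1 y2 c d z : x1 <= x2 -> y1 <= y2 ->
  rint (fun w => c + d * (w - z)) x1 x2 y1 y2 = 0.
Proof.
move=> hx hy.
have H x : pcont_on x1 x2 (fun t => c + d * (t +i* x - z)).
  by move=> t ht; apply: (ccont_pconth (fun w => c + d * (w - z))); exact: ccont_affine.
have V x : pcont_on y1 y2 (fun t => c + d * (x +i* t - z)).
  by move=> t ht; apply: (ccont_pcontv (fun w => c + d * (w - z))); exact: ccont_affine.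
rewrite /rint -!cintB //.
rewrite (_ : cint x1 x2 _ = cint x1 x2 (fun=> 'i * (y1 - y2)%:C * d)); last first.
  apply: eq_cint => t ht.
  rewrite (_ : 'i * (y1 - y2)%:C = (t +i* y1) - (t +i* y2)).
    by ring.
  by apply/eqP; rewrite eq_complex /=; apply/andP; split; apply/eqP; ring.
rewrite (_ : cint y1 y2 _ = cint y1 y2 (fun=> (x2 - x1)%:C * d)); last first.
  apply: eq_cint => t ht.
  rewrite (_ : (x2 - x1)%:C = (x2 +i* t) - (x1 +i* t)).
    by ring.
  by apply/eqP; rewrite eq_complex /=; apply/andP; split; apply/eqP; ring.
rewrite !cint_cst // !rmorphB /=; ring.
Qed.

Lemma rint_splitx x1 m x2 y1 y2 g : x1 <= m <= x2 -> y1 <= y2 ->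
  (forall z, inrect x1 x2 y1 y2 z -> ccont g z) ->
  rint g x1 x2 y1 y2 = rint g x1 m y1 y2 + rint g m x2 y1 y2.
Proof.
move=> hm hy hg; have hx : x1 <= x2 by case/andP: hm; exact: le_trans.
have [h1 h2 _ _] := on_edges_pcont _ _ _ _ _ (on_edges_rect _ _ _ _ _ hx hy hg).
by rewrite /rint !(cint_split x1 m x2) //; ring.
Qed.

Lemma rint_splity x1 x2 y1 m y2 g : x1 <= x2 -> y1 <= m <= y2 ->
  (forall z, inrect x1 x2 y1 y2 z -> ccont g z) ->
  rint g x1 x2 y1 y2 = rint g x1 x2 y1 m + rint g x1 x2 m y2.
Proof.
move=> hx hm hg; have hy : y1 <= y2 by case/andP: hm; exact: le_trans.
have [_ _ h1 h2] := on_edges_pcont _ _ _ _ _ (on_edges_rect _ _ _ _ _ hx hy hg).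
by rewrite /rint !(cint_split y1 m y2) //; ring.
Qed.

Lemma inrectS x1 x2 y1 y2 x1' x2' y1' y2' z :
  x1 <= x1' -> x2' <= x2 -> y1 <= y1' -> y2' <= y2 ->
  inrect x1' x2' y1' y2' z -> inrect x1 x2 y1 y2 z.
Proof. rewrite /inrect; lra. Qed.

End rectangle_integral.

Section goursat.
Context {R : realType}.
Implicit Types (g : R[i]^o -> R[i]^o) (z w c d : R[i]^o) (x y : R).

Lemma nested_point (u v : nat -> R) :
  (forall n, u n <= u n.+1) -> (forall n, v n.+1 <= v n) ->
  (forall n, u n <= v n) -> exists x, forall n, u n <= x <= v n.
Proof.
move=> hu hv huv.
have mu m n : (m <= n)%N -> u m <= u n.
  by apply: (homo_leq (r := fun a b => a <= b)) => //; exact: le_trans.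
have mv m n : (m <= n)%N -> v n <= v m.
  apply: (homo_leq (r := fun a b => b <= a)) => // a b c h1 h2.
  exact: le_trans h2 h1.
have ub m n : u m <= v n.
  apply: le_trans (mu _ _ (leq_maxl m n)) _.
  by apply: le_trans (mv _ _ (leq_maxr m n)).
exists (sup (range u)) => n; apply/andP; split.
  apply: ub_le_sup; last by exists n.
  by exists (v 0%N) => _ [m _ <-].
apply: ge_sup; first by exists (u 0%N); exists 0%N.
by move=> _ [m _ <-].
Qed.

(** The boundary integrals of the four quarters add up to the whole, since inner edges cancel; by
    pigeonhole one quarter carries at least a quarter of the modulus. *)
Lemma quarter_rect g x x' y y' a b :
  0 <= a -> 0 <= b -> x' = x + (a + a) -> y' = y + (b + b) ->
  (forall z, inrect x x' y y' z -> ccont g z) ->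
  exists s t, [/\ s = x \/ s = x + a, t = y \/ t = y + b &
    normc (rint g x x' y y') <= 4 * normc (rint g s (s + a) t (t + b))].
Proof.
move=> a0 b0 -> -> hg.
have E : rint g x (x + (a + a)) y (y + (b + b)) =
   (rint g x (x + a) y (y + b) + rint g x (x + a) (y + b) (y + b + b)) +
   (rint g (x + a) (x + a + a) y (y + b) +
    rint g (x + a) (x + a + a) (y + b) (y + b + b)).
  rewrite (rint_splitx _ (x + a)) //; [|lra|lra].
  rewrite (rint_splity _ (x + a) _ (y + b)) //; [|lra|lra|]; last first.
    move=> z hz; apply: hg; apply: inrectS hz; lra.
  rewrite (rint_splity (x + a) _ _ (y + b)) //; [|lra|lra|]; last first.
    move=> z hz; apply: hg; apply: inrectS hz; lra.
  by rewrite !addrA.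
set N := normc _.
have hN : N <= normc (rint g x (x + a) y (y + b)) +
   normc (rint g x (x + a) (y + b) (y + b + b)) +
   (normc (rint g (x + a) (x + a + a) y (y + b)) +
    normc (rint g (x + a) (x + a + a) (y + b) (y + b + b))).
  rewrite /N E; apply: le_trans (normcD _ _) _.
  by apply: lerD; exact: normcD.
have [h1|h1] := leP N (4 * normc (rint g x (x + a) y (y + b))).
  by exists x, y; split => //; left.
have [h2|h2] := leP N (4 * normc (rint g x (x + a) (y + b) (y + b + b))).
  by exists x, (y + b); split => //; [left|right].
have [h3|h3] := leP N (4 * normc (rint g (x + a) (x + a + a) y (y + b))).
  by exists (x + a), y; split => //; [right|left].
exists (x + a), (y + b); split; [by right|by right|].
lra.
Qed.

(** Repeated quartering yields nested rectangles whose integrals stay at least $\eta 4^{-n}$ in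
    modulus. At their common point the function is affine up to an error $e|w-z|$, which bounds the
    same integrals by a constant times $e4^{-n}$; a small [e] gives a contradiction. *)
Lemma goursat g x1 x2 y1 y2 : x1 <= x2 -> y1 <= y2 ->
  (forall z, inrect x1 x2 y1 y2 z -> exists d, is_cderive g z d) ->
  rint g x1 x2 y1 y2 = 0.
Proof.
move=> hx hy hg.
have cg z : inrect x1 x2 y1 y2 z -> ccont g z.
  by move=> /hg[d]; exact: is_cderive_ccont.
pose a := x2 - x1; pose b := y2 - y1.
have a0 : 0 <= a by rewrite subr_ge0.
have b0 : 0 <= b by rewrite subr_ge0.
pose q n : R := 2^-1 ^+ n.
have q0 n : 0 < q n by rewrite exprn_gt0 // invr_gt0.
have qS n : q n = q n.+1 + q n.+1 by rewrite /q exprS; lra.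
set eta := normc (rint g x1 x2 y1 y2).
apply: eq0_normc; rewrite -/eta; apply/eqP.
have : 0 <= eta := normc_ge0 _.
rewrite le_eqVlt => /orP[/eqP <- //|eta0]; exfalso.
(* A state is a lower left corner with a depth [n]; the rectangle has sides [a * q n] and [b * q n],
   and [q n * q n] is $4^{-n}$. *)
pose P (s : R * R * nat) := let: (x, y, n) := s in
  [/\ x1 <= x, x + a * q n <= x2, y1 <= y, y + b * q n <= y2 &
   eta * (q n * q n) <= normc (rint g x (x + a * q n) y (y + b * q n))].
pose Q (s t : R * R * nat) := let: (x, y, n) := s in let: (x', y', n') := t in
  [/\ n' = n.+1, x <= x', x' + a * q n' <= x + a * q n, y <= y' &
   y' + b * q n' <= y + b * q n].
have step (s : {s | P s}) : {t : {t | P t} | Q (sval s) (sval t)}.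
  apply: cid; case: s => [[[x y] n] [p1 p2 p3 p4 p5]] /=.
  have aq : 0 <= a * q n.+1 by rewrite mulr_ge0 // ltW.
  have bq : 0 <= b * q n.+1 by rewrite mulr_ge0 // ltW.
  have ea : a * q n = a * q n.+1 + a * q n.+1 by rewrite qS mulrDr.
  have eb : b * q n = b * q n.+1 + b * q n.+1 by rewrite qS mulrDr.
  have [] := @quarter_rect g x (x + a * q n) y (y + b * q n) _ _ aq bq.
  - by rewrite ea.
  - by rewrite eb.
  - by move=> z hz; apply: cg; apply: inrectS hz.
  move=> s [t [hs ht hst]].
  have Pt : P (s, t, n.+1).
    have := le_trans p5 hst; rewrite (qS n) => h.
    by split; [case: hs => ->; lra|case: hs => ->; lra|case: ht => ->; lra|
      case: ht => ->; lra|lra].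
  by exists (exist _ _ Pt); rewrite /Q /=; split => //;
    [case: hs => ->; lra|case: hs => ->; lra|case: ht => ->; lra|
      case: ht => ->; lra].
have P0 : P (x1, y1, 0%N).
  have e1 : x1 + (x2 - x1) = x2 by ring.
  have e2 : y1 + (y2 - y1) = y2 by ring.
  by rewrite /P /q expr0 !mulr1 /a /b e1 e2; split.
have [F [F0 FS]] := dependent_choice step (exist _ _ P0).
pose X n := (sval (F n)).1.1; pose Y n := (sval (F n)).1.2.
have Fn n : sval (F n) = (X n, Y n, n).
  rewrite /X /Y; elim: n => [|n]; first by rewrite F0.
  move: (FS n); case: (sval (F n)) => [[x y] m]; case: (sval (F n.+1)) => [[x' y'] m'].
  by move=> [-> _ _ _ _] [->].
have PF n : P (X n, Y n, n) by rewrite -Fn; exact: svalP.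
have QF n : Q (X n, Y n, n) (X n.+1, Y n.+1, n.+1) by rewrite -!Fn.
have [p hp] : exists p, forall n, X n <= p <= X n + a * q n.
  apply: nested_point => n; try by case: (QF n).
  by rewrite lerDl mulr_ge0 // ltW.
have [r hr] : exists r, forall n, Y n <= r <= Y n + b * q n.
  apply: nested_point => n; try by case: (QF n).
  by rewrite lerDl mulr_ge0 // ltW.
pose z : R[i]^o := p +i* r.
have hz : inrect x1 x2 y1 y2 z.
  have := hp 0%N; have := hr 0%N; have := PF 0%N; rewrite /P /inrect /=.
  move=> [? ? ? ? _]; lra.
have [d hd] := hg z hz.
pose D := a + b.
have D0 : 0 <= D by rewrite addr_ge0.
(* [D * q n] bounds both the distance to [z] and the sum of the two sides, so the final bound is
   $4eD^2 4^{-n}$. This [e] makes it smaller than $\eta 4^{-n}$; the [+ 1] covers [D = 0]. *)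
pose e := eta / (4 * (D * D) + 1).
have DD1 : 0 < 4 * (D * D) + 1 by have := mulr_ge0 D0 D0; lra.
have e0 : 0 < e by rewrite divr_gt0.
have [rho rho0 hrho] := hd e e0.
have [n hn] : exists n, D * q n < rho.
  have : (fun n => D * q n) @ \oo --> D * 0.
    apply: cvgMr; apply: cvg_expr; rewrite ger0_norm ?invr_ge0 // invf_lt1 // ltr1n //.
  rewrite mulr0 => /cvgrPdist_lt /(_ _ rho0) [N _ /(_ N (leqnn N))] /=.
  rewrite sub0r normrN => h; exists N; apply: le_lt_trans h; exact: ler_norm.
have [p1 p2 p3 p4 p5] := PF n.
have aq : 0 <= a * q n by rewrite mulr_ge0 // ltW.
have bq : 0 <= b * q n by rewrite mulr_ge0 // ltW.
have sub w : inrect (X n) (X n + a * q n) (Y n) (Y n + b * q n) w ->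
    inrect x1 x2 y1 y2 w by exact: inrectS.
have near w : inrect (X n) (X n + a * q n) (Y n) (Y n + b * q n) w ->
    normc (w - z) <= D * q n.
  case: w => u v; rewrite /inrect /= => /andP[hu hv].
  apply: le_trans (normc_ReIm ((u - p) +i* (v - r))) _; rewrite /= mulrDl; apply: lerD;
    rewrite ler_norml; move: (hp n) (hr n) hu hv; lra.
have E : rint g (X n) (X n + a * q n) (Y n) (Y n + b * q n) =
   rint (fun w => g w - (g z + d * (w - z))) (X n) (X n + a * q n) (Y n) (Y n + b * q n).
  rewrite rintB; last 2 first.
  - by apply: on_edges_rect; rewrite ?lerDl // => w /sub /cg.
  - by apply: on_edges_rect; rewrite ?lerDl // => w _; exact: ccont_affine.
  by rewrite rint_affine ?lerDl // subr0.
have B : normc (rint g (X n) (X n + a * q n) (Y n) (Y n + b * q n)) <=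
    4 * (e * (D * q n)) * (D * q n).
  rewrite E; apply: (le_trans (rint_bound _ _ _ _ _ (e * (D * q n)) _ _ _ _)).
  - by rewrite lerDl.
  - by rewrite lerDl.
  - apply: on_edges_rect; rewrite ?lerDl // => w /sub /cg hw.
    by apply: ccontB => //; exact: ccont_affine.
  - apply: on_edges_rect; rewrite ?lerDl // => w hw.
    rewrite opprD addrA; apply: le_trans (hrho w _) _.
      by apply: le_lt_trans hn; exact: near.
    by apply: ler_wpM2l; [exact: ltW|exact: near].
  by rewrite /D mulrDl; lra.
have := le_trans p5 B.
have -> : 4 * (e * (D * q n)) * (D * q n) = e * (4 * (D * D)) * (q n * q n) by ring.
rewrite ler_pM2r ?mulr_gt0 //.
apply/negP; rewrite -ltNge /e mulrAC ltr_pdivrMr // ltr_pM2l //; lra.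
Qed.

End goursat.

Section goursat_exceptional.
Context {R : realType}.
Implicit Types (g u : R[i]^o -> R[i]^o) (z w b c d : R[i]^o) (x y s : R).

Lemma rint_degenerate_x g x y1 y2 : rint g x x y1 y2 = 0.
Proof. by rewrite /rint !cintxx; ring. Qed.

Lemma rint_degenerate_y g x1 x2 y : rint g x1 x2 y y = 0.
Proof. by rewrite /rint !cintxx; ring. Qed.

(* Around an exceptional point only continuity is known; a small square about it
   contributes little, and the rest splits into rectangles avoiding it. *)
Lemma goursat_seq (S : seq R[i]^o) g x1 x2 y1 y2 : x1 <= x2 -> y1 <= y2 ->
  (forall z, inrect x1 x2 y1 y2 z -> ccont g z) ->
  (forall z, inrect x1 x2 y1 y2 z -> z \notin S -> exists d, is_cderive g z d) ->
  rint g x1 x2 y1 y2 = 0.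
Proof.
elim: S x1 x2 y1 y2 => [|b S IH] x1 x2 y1 y2 hx hy cg hg.
  by apply: goursat => // z hz; exact: hg.
(* A rectangle that misses [b] has its exceptional points in [S], so the induction hypothesis
   applies. *)
have IHb s1 s2 t1 t2 : s1 <= s2 -> t1 <= t2 ->
    (forall z, inrect s1 s2 t1 t2 z -> inrect x1 x2 y1 y2 z) ->
    ~~ inrect s1 s2 t1 t2 b -> rint g s1 s2 t1 t2 = 0.
  move=> hs ht hsub nb; apply: IH => // z hz; first exact/cg/hsub.
  move=> zS; apply: hg; first exact: hsub.
  by rewrite inE negb_or zS andbT; apply: contraNneq nb => <-.
have [inb|] := boolP (inrect x1 x2 y1 y2 b); last exact: IHb.
have [r r0 hr] := cg b inb 1 ltr01.
have [B BE] : exists B, B = normc (g b) + 1 by eexists.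
have B0 : 0 < B by rewrite BE ltr_wpDl ?normc_ge0.
suff small e : 0 < e -> e + e < r -> normc (rint g x1 x2 y1 y2) <= 16 * B * e.
  apply: eq0_normc; apply/eqP; rewrite eq_le normc_ge0 andbT.
  apply/ler_addgt0Pr => e e0; rewrite add0r.
  pose k := Num.min (r / 3) (e / (16 * B)).
  have k0 : 0 < k by rewrite lt_min !divr_gt0 ?mulr_gt0.
  have kr : k <= r / 3 by rewrite ge_min lexx.
  have ke : k <= e / (16 * B) by rewrite ge_min lexx orbT.
  apply: le_trans (small k k0 _) _; first lra.
  by rewrite mulrC -ler_pdivlMr // mulr_gt0.
move=> e0 er.
case: b inb IHb hr BE {hg} => p q inb IHb hr BE.
have /andP[/andP[xp px] /andP[yq qy]] : (x1 <= p <= x2) && (y1 <= q <= y2).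
  exact: inb.
(* The square of half-side [e] about [b], clipped to the rectangle. Each of the four remaining
   strips either misses [b] or, where the square is clipped, has width zero. *)
pose al := Num.max x1 (p - e); pose be := Num.min x2 (p + e).
pose ga := Num.max y1 (q - e); pose de := Num.min y2 (q + e).
have [al1 al2 al3] : [/\ x1 <= al, al <= p & p - e <= al].
  by rewrite /al !le_max !ge_max lexx xp lexx orbT /=; split => //; lra.
have [be1 be2 be3] : [/\ be <= x2, p <= be & be <= p + e].
  by rewrite /be !ge_min !le_min lexx px lexx orbT /=; split => //; lra.
have [ga1 ga2 ga3] : [/\ y1 <= ga, ga <= q & q - e <= ga].
  by rewrite /ga !le_max !ge_max lexx yq lexx orbT /=; split => //; lra.
have [de1 de2 de3] : [/\ de <= y2, q <= de & de <= q + e].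
  by rewrite /de !ge_min !le_min lexx qy lexx orbT /=; split => //; lra.
have Z1 : rint g x1 al y1 y2 = 0.
  have [E|E] := leP x1 (p - e); last first.
    by rewrite /al (max_idPl (ltW E)) rint_degenerate_x.
  apply: IHb => //.
    move=> z; apply: inrectS => //; lra.
  by rewrite /inrect /= /al (max_idPr E); lra.
have Z2 : rint g be x2 y1 y2 = 0.
  have [E|E] := leP (p + e) x2; last first.
    by rewrite /be (min_idPl (ltW E)) rint_degenerate_x.
  apply: IHb => //.
    move=> z; apply: inrectS => //; lra.
  by rewrite /inrect /= /be (min_idPr E); lra.
have Z3 : rint g al be y1 ga = 0.
  have [E|E] := leP y1 (q - e); last first.
    by rewrite /ga (max_idPl (ltW E)) rint_degenerate_y.
  apply: IHb => //; first lra.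
    move=> z; apply: inrectS => //; lra.
  by rewrite /inrect /= /ga (max_idPr E); lra.
have Z4 : rint g al be de y2 = 0.
  have [E|E] := leP (q + e) y2; last first.
    by rewrite /de (min_idPl (ltW E)) rint_degenerate_y.
  apply: IHb => //; first lra.
    move=> z; apply: inrectS => //; lra.
  by rewrite /inrect /= /de (min_idPr E); lra.
rewrite (rint_splitx _ al) //; last by lra.
rewrite (rint_splitx al be) //; [|lra|]; last first.
  move=> z hz; apply: cg; apply: inrectS hz; lra.
rewrite (rint_splity al be y1 ga) //; [|lra|lra|]; last first.
  move=> z hz; apply: cg; apply: inrectS hz; lra.
rewrite (rint_splity al be ga de) //; [|lra|lra|]; last first.
  move=> z hz; apply: cg; apply: inrectS hz; lra.
rewrite Z1 Z2 Z3 Z4 !add0r !addr0.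
have abe : al <= be by lra.
have gde : ga <= de by lra.
apply: (le_trans (rint_bound _ _ _ _ _ B _ _ _ _)) => //.
- apply: on_edges_rect => // z hz; apply: cg; apply: inrectS hz; lra.
- apply: on_edges_rect => // -[s t] /=; rewrite /inrect /= => hz.
  have := normcD (g (s +i* t) - g (p +i* q)) (g (p +i* q)); rewrite subrK.
  have /hr : normc (s +i* t - p +i* q : R[i]) < r.
    apply: le_lt_trans (normc_ReIm ((s - p) +i* (t - q))) _ => /=.
    apply: le_lt_trans er; apply: lerD; rewrite ler_norml; lra.
  rewrite BE; lra.
have -> : 16 * B * e = 4 * B * (4 * e) by ring.
apply: ler_wpM2l; lra.
Qed.

End goursat_exceptional.

(** * Cauchy estimates on squares *)

Section cauchy_estimates.
Context {R : realType}.
Implicit Types (f u : R[i]^o -> R[i]^o) (z w a b c d : R[i]^o) (x y s M : R).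

(** The value [d] at [b] removes the singularity: when [d] is the derivative, the quotient is
    continuous at [b] and inherits differentiability elsewhere, exactly the situation that
    [goursat_seq] admits. *)
Definition dquot u b d : R[i]^o -> R[i]^o :=
  fun w => if w == b then d else (u w - u b) / (w - b).

Lemma dquotE u b d w : w != b -> dquot u b d w = (u w - u b) / (w - b).
Proof. by rewrite /dquot => /negbTE ->. Qed.

Lemma dquotK u b d w : u w = u b + dquot u b d w * (w - b).
Proof.
rewrite /dquot; case: eqP => [->|/eqP wb]; first by rewrite subrr mulr0 addr0.
by rewrite mulrVK ?unitfE ?subr_eq0 // addrC subrK.
Qed.

Lemma dquot_ccont_at u b d : is_cderive u b d -> ccont (dquot u b d) b.
Proof.
move/is_cderiveP => [p [pb cp] [r r0 hr]].
apply: ccont_near_eq r0 _ cp => w /hr; rewrite /dquot.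
case: eqP => [-> //|/eqP wb ->].
by rewrite mulfK // subr_eq0.
Qed.

Lemma dquot_near u b d w : w != b -> exists2 r : R, 0 < r &
  forall v, normc (v - w) < r -> (u v - u b) * (v - b)^-1 = dquot u b d v.
Proof.
move=> wb; exists (normc (b - w)).
  by rewrite normc_gt0 // subr_eq0 eq_sym.
by move=> v hv; rewrite dquotE //; apply: contraTneq hv => ->; rewrite ltxx.
Qed.

Lemma dquot_ccont u b d w : w != b -> ccont u w -> ccont (dquot u b d) w.
Proof.
move=> wb cu; have [r r0 hr] := dquot_near u b d w wb.
apply: ccont_near_eq r0 hr _.
apply: ccontM; first by apply: ccontB => //; exact: ccont_cst.
apply: ccontV; first by rewrite subr_eq0.
by apply: ccontB; [exact: ccont_id|exact: ccont_cst].
Qed.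

Lemma dquot_cderive u b d w : w != b -> (exists e, is_cderive u w e) ->
  exists e, is_cderive (dquot u b d) w e.
Proof.
move=> wb [e he]; have [r r0 hr] := dquot_near u b d w wb.
eexists; apply: is_cderive_near_eq r0 hr _.
apply: is_cderiveM; first by apply: is_cderiveD he _; exact: is_cderive_cst.
apply: (@is_cderiveV R (fun v => v - b)); first by rewrite subr_eq0.
by apply: is_cderiveD; [exact: is_cderive_id|exact: is_cderive_cst].
Qed.

Definition in_square z s := inrect (complex.Re z - s) (complex.Re z + s)
  (complex.Im z - s) (complex.Im z + s).

Definition square_rint u z s := rint u (complex.Re z - s) (complex.Re z + s)
  (complex.Im z - s) (complex.Im z + s).

Definition on_square z s := on_edges (complex.Re z - s) (complex.Re z + s)
  (complex.Im z - s) (complex.Im z + s).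

Lemma in_square_normc z s w : in_square z s w -> normc (w - z) <= 2 * s.
Proof.
case: w z => [p q] [x y]; rewrite /in_square /inrect /= => h.
apply: le_trans (normc_ReIm ((p - x) +i* (q - y))) _ => /=.
rewrite mulr2n mulrDl mul1r; apply: lerD; rewrite ler_norml; lra.
Qed.

Lemma on_square_normc z s : 0 < s ->
  on_square z s (fun w => s <= normc (w - z) /\ in_square z s w).
Proof.
case: z => x y s0; have sN : s = `|- s| by rewrite normrN gtr0_norm.
have sP : s = `|s| by rewrite gtr0_norm.
split => t ht; split; split; rewrite /in_square /inrect /= ?ht ?andbT //=.
- apply: le_trans (normc_Im ((t - x) +i* (y - s - y))) => /=.
  by rewrite addrAC subrr sub0r -sN.
- lra.
- apply: le_trans (normc_Im ((t - x) +i* (y + s - y))) => /=.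
  by rewrite addrAC subrr add0r -sP.
- lra.
- apply: le_trans (normc_Re ((x - s - x) +i* (t - y))) => /=.
  by rewrite addrAC subrr sub0r -sN.
- lra.
- apply: le_trans (normc_Re ((x + s - x) +i* (t - y))) => /=.
  by rewrite addrAC subrr add0r -sP.
- lra.
Qed.

Lemma on_edgesW x1 x2 y1 y2 (P Q : R[i]^o -> Prop) :
  (forall z, P z -> Q z) -> on_edges x1 x2 y1 y2 P -> on_edges x1 x2 y1 y2 Q.
Proof.
by move=> PQ [hx hy]; split => t /[dup] ht; [case/hx|case/hy]; split; exact: PQ.
Qed.

Lemma kernel_ccont z w : w != z -> ccont (fun v => (v - z)^-1) w.
Proof.
move=> wz; apply: ccontV; first by rewrite subr_eq0.
by apply: ccontB; [exact: ccont_id|exact: ccont_cst].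
Qed.

(** With the orientation taken into account, the right-hand side is the imaginary part of the
    integrand of $dw/(w-z)$ on a side of the square. A side has length $2s$, hence contributes at
    least 1. *)
Lemma kernel_bound (s t : R) : 0 < s -> - s <= t <= s ->
  (2 * s)^-1 <= s / (t ^+ 2 + s ^+ 2).
Proof.
move=> s0 ht; have h : t ^+ 2 <= s ^+ 2.
  by rewrite -ler_sqrt ?sqr_ge0 // !sqrtr_sqr (gtr0_norm s0) ler_norml.
have s2 : 0 < s ^+ 2 by rewrite exprn_gt0.
have t2 : 0 <= t ^+ 2 := sqr_ge0 t.
rewrite -[X in X <= _]mul1r ler_pdivrMr; last by rewrite mulr_gt0.
rewrite mulrAC ler_pdivlMr; last by lra.
rewrite mul1r; move: h; rewrite !expr2; lra.
Qed.

(* A crude form of Cauchy's integral of 1/(w - z), whose value is 2 pi i. *)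
Lemma square_rint_kernel z s : 0 < s ->
  4 <= normc (square_rint (fun w => (w - z)^-1) z s).
Proof.
case: z => x y s0; set z := x +i* y.
apply: le_trans (normc_Im _); apply: le_trans (ler_norm _).
have ce : on_square z s (ccont (fun w => (w - z)^-1)).
  apply: on_edgesW (on_square_normc z s s0) => w [h _].
  apply: kernel_ccont; apply: contraTneq h => ->.
  by rewrite subrr normc0 -ltNge.
have [p1 p2 p3 p4] := on_edges_pcont _ _ _ _ _ ce.
rewrite /square_rint /rint -[complex.Re z]/x -[complex.Im z]/y.
have Z (c : R[i]) (q : R -> R[i]) (m n : R) : pcont_on m n q ->
    pcont_on m n (fun t => c * q t).
  move=> hq t ht e e0; have c0 : 0 < normc c + 1 by rewrite ltr_wpDl ?normc_ge0.
  have [r r0 hr] := hq t ht (e / (normc c + 1)) (divr_gt0 e0 c0).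
  exists r => // v /hr; rewrite -mulrBr normcM ltr_pdivlMr // => k.
  apply: le_lt_trans k; rewrite mulrC; apply: ler_wpM2l; rewrite ?normc_ge0 //.
  by rewrite lerDl.
have ss : 0 < 2 * s by rewrite mulr_gt0.
have E m : m - s <= m + s by lra.
have half m (q : R -> R[i]) : pcont_on (m - s) (m + s) q ->
   (forall t, m - s <= t <= m + s -> (2 * s)^-1 <= complex.Im (q t)) ->
   1 <= complex.Im (cint (m - s) (m + s) q).
  move=> cq hq; have := cint_Im_ge _ _ _ _ (E m) cq hq.
  have -> : m + s - (m - s) = 2 * s by ring.
  by rewrite mulVf // gt_eqF.
have sub (m t : R) : m - s <= t <= m + s -> - s <= t - m <= s by lra.
(* The factors [-1], [- 'i] and ['i] account for the orientation of the top, left and right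
   sides. *)
have c1 := half _ _ p1; have c2 := half _ _ (Z (-1) _ _ _ p2).
have c3 := half _ _ (Z (- 'i) _ _ _ p3); have c4 := half _ _ (Z 'i _ _ _ p4).
rewrite -/z in c1 c2 c3 c4.
have {}c1 : 1 <= complex.Im (cint (x - s) (x + s) (fun t => (t +i* (y - s) - z)^-1)).
  apply: c1 => t ht /=; apply: le_trans (kernel_bound s (t - x) s0 (sub _ _ ht)) _.
  rewrite le_eqVlt; apply/orP; left; apply/eqP.
  have -> : y - s - y = - s by ring.
  by field; have := sqr_ge0 (t - x); have := exprn_gt0 2 s0; lra.
have {}c2 : 1 <= complex.Im (cint (x - s) (x + s) (fun t => -1 * (t +i* (y + s) - z)^-1)).
  apply: c2 => t ht /=; apply: le_trans (kernel_bound s (t - x) s0 (sub _ _ ht)) _.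
  rewrite le_eqVlt; apply/orP; left; apply/eqP; rewrite -mulNr.
  have -> : y + s - y = s by ring.
  by field; have := sqr_ge0 (t - x); have := exprn_gt0 2 s0; lra.
have {}c3 : 1 <= complex.Im (cint (y - s) (y + s) (fun t => - 'i * ((x - s) +i* t - z)^-1)).
  apply: c3 => t ht /=; apply: le_trans (kernel_bound s (t - y) s0 (sub _ _ ht)) _.
  rewrite le_eqVlt; apply/orP; left; apply/eqP.
  have -> : x - s - x = - s by ring.
  by field; have := sqr_ge0 (t - y); have := exprn_gt0 2 s0; lra.
have {}c4 : 1 <= complex.Im (cint (y - s) (y + s) (fun t => 'i * ((x + s) +i* t - z)^-1)).
  apply: c4 => t ht /=; apply: le_trans (kernel_bound s (t - y) s0 (sub _ _ ht)) _.
  rewrite le_eqVlt; apply/orP; left; apply/eqP.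
  have -> : x + s - x = s by ring.
  by field; have := sqr_ge0 (t - y); have := exprn_gt0 2 s0; lra.
move: c1 c2 c3 c4; rewrite !cintZ //.
case: (cint _ _ _) => a1 b1; case: (cint _ _ _) => a2 b2.
case: (cint _ _ _) => a3 b3; case: (cint _ _ _) => a4 b4 /=.
lra.
Qed.

(** The quotient $(u(w)-u(z))/(w-z)$ integrates to 0, so $u(z)$ times the kernel integral equals the
    integral of $u(w)/(w-z)$. The kernel integral has modulus at least 4, the other at most
    $4(M/s)(4s)=16M$. *)
Lemma center_bound (S : seq R[i]^o) u z s M : 0 < s ->
  (forall w, in_square z s w -> ccont u w) ->
  (forall w, in_square z s w -> w \notin S -> exists d, is_cderive u w d) ->
  z \notin S -> on_square z s (fun w => normc (u w) <= M) ->
  normc (u z) <= 4 * M.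
Proof.
move=> s0 cu du zS hM.
have ez := on_square_normc z s s0.
have zin : in_square z s z by rewrite /in_square /inrect; lra.
have [d hd] := du z zin zS.
have E m : m - s <= m + s by lra.
have wz w : s <= normc (w - z) -> w != z.
  by move=> h; apply: contraTneq h => ->; rewrite subrr normc0 -ltNge.
have I0 : square_rint (dquot u z d) z s = 0.
  apply: (goursat_seq (z :: S)) => // w hw.
    have [->|wz'] := eqVneq w z; first exact: dquot_ccont_at.
    by apply: dquot_ccont => //; exact: cu.
  rewrite inE negb_or => /andP[wz' wS].
  by apply: dquot_cderive => //; exact: du.
have ck : on_square z s (ccont (fun w => (w - z)^-1)).
  by apply: on_edgesW ez => w [h _]; apply: kernel_ccont; exact: wz.
have cuk : on_square z s (ccont (fun w => u w * (w - z)^-1)).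
  apply: on_edgesW ez => w [h hin]; apply: ccontM; first exact: cu.
  by apply: kernel_ccont; exact: wz.
have czk : on_square z s (ccont (fun w => u z * (w - z)^-1)).
  by apply: on_edgesW ck => w hw; apply: ccontM => //; exact: ccont_cst.
have I1 : square_rint (dquot u z d) z s =
    square_rint (fun w => u w * (w - z)^-1) z s -
    u z * square_rint (fun w => (w - z)^-1) z s.
  rewrite /square_rint -rintZ // -rintB //; apply: eq_rint.
  by apply: on_edgesW ez => w [/wz h _]; rewrite dquotE // mulrBl.
have B : normc (square_rint (fun w => u w * (w - z)^-1) z s) <= 16 * M.
  apply: (le_trans (rint_bound _ _ _ _ _ (M / s) _ _ _ _)) => //.
    case: hM => hMx hMy; case: ez => ezx ezy; split => t ht.
      have [m1 m2] := hMx t ht; have [[e1 _] [e2 _]] := ezx t ht.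
      split; rewrite normcM normcV; apply: ler_pM;
        rewrite ?normc_ge0 ?invr_ge0 ?normc_ge0 // lef_pV2 // posrE //;
        by apply: lt_le_trans s0 _.
    have [m1 m2] := hMy t ht; have [[e1 _] [e2 _]] := ezy t ht.
    split; rewrite normcM normcV; apply: ler_pM;
      rewrite ?normc_ge0 ?invr_ge0 ?normc_ge0 // lef_pV2 // posrE //;
      by apply: lt_le_trans s0 _.
  rewrite le_eqVlt; apply/orP; left; apply/eqP; field; lra.
move: I0; rewrite I1 => /eqP; rewrite subr_eq0 => /eqP I2.
move: B; rewrite I2 normcM => B.
have := square_rint_kernel z s s0.
move=> /(ler_wpM2l (normc_ge0 (u z))); move: B; lra.
Qed.

(** Carries an estimate obtained at nearby points over to an exceptional point, where only
    continuity is at hand. *)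
Lemma le_normc_limit u a d (B : R) : ccont u a ->
  (forall e : R, 0 < e -> exists2 b, normc (b - a) < e & normc (u b - d) <= B + e) ->
  normc (u a - d) <= B.
Proof.
move=> cu h; apply/ler_addgt0Pr => e e0.
have e2 : 0 < e / 2 by rewrite divr_gt0.
have [r r0 hr] := cu _ e2.
have k0 : 0 < Num.min r (e / 2) by rewrite lt_min r0.
have [b ba hb] := h _ k0.
have : normc (b - a) < r by rewrite (lt_le_trans ba) // ge_min lexx.
move=> /hr; rewrite normcB => hb2.
have : Num.min r (e / 2) <= e / 2 by rewrite ge_min lexx orbT.
have := normc_triangle (u a) (u b) d; lra.
Qed.

(** [center_bound] is applied at [b2] to the difference quotient based at [b1], which joins the
    exceptional points. On the boundary of the square about [b2] the distance to [b1] is at least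
    $s/2$, so the quotient is at most $2M/(s/2)$. The list [S] allows [u] to be itself a difference
    quotient. *)
Lemma lipschitz_near (S : seq R[i]^o) u a s M b1 b2 : 0 < s ->
  (forall w, normc (w - a) < 4 * s -> ccont u w) ->
  (forall w, normc (w - a) < 4 * s -> w \notin S -> exists d, is_cderive u w d) ->
  (forall w, normc (w - a) < 4 * s -> normc (u w) <= M) ->
  normc (b1 - a) < s / 4 -> normc (b2 - a) < s / 4 ->
  b1 \notin S -> b2 \notin S -> normc (u b2 - u b1) <= 16 * M / s * normc (b2 - b1).
Proof.
move=> s0 cu du uM h1 h2 b1S b2S.
have [->|b12] := eqVneq b2 b1; first by rewrite !subrr normc0 mulr0.
have h1' : normc (b1 - a) < 4 * s by lra.
have [d1 hd1] := du _ h1' b1S.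
have far w : normc (w - b2) <= 2 * s -> normc (w - a) < 4 * s.
  by have := normc_triangle w b2 a; lra.
have M0 : 0 <= M by apply: le_trans (uM _ h1'); exact: normc_ge0.
have : normc (dquot u b1 d1 b2) <= 4 * (4 * M / s).
  apply: (center_bound (b1 :: S) _ _ _ _ s0).
  - move=> w /in_square_normc /far hw; have [->|wb] := eqVneq w b1.
      exact: dquot_ccont_at.
    by apply: dquot_ccont => //; exact: cu.
  - move=> w /in_square_normc /far hw; rewrite inE negb_or => /andP[wb wS].
    by apply: dquot_cderive => //; exact: du.
  - by rewrite inE negb_or b12.
  apply: on_edgesW (on_square_normc b2 s s0) => w [ws].
  move=> /in_square_normc /far hw.
  have wb : s / 2 <= normc (w - b1).
    have := normc_triangle w b1 b2; have := normc_triangle b1 a b2.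
    by rewrite (normcB a b2); lra.
  have wb1 : w != b1.
    by apply: contraTneq wb => ->; rewrite subrr normc0 -ltNge divr_gt0.
  rewrite dquotE // normcM normcV ler_pdivrMr; last by lra.
  have k : normc (u w - u b1) <= 2 * M.
    have := normcD (u w) (- u b1); rewrite normcN.
    by have := uM _ hw; have := uM _ h1'; lra.
  apply: le_trans k _.
  have /ler_wpM2l : 0 <= 4 * M / s by rewrite divr_ge0 ?mulr_ge0 // ltW.
  move/(_ _ _ wb); apply: le_trans.
  by rewrite le_eqVlt; apply/orP; left; apply/eqP; field; lra.
rewrite dquotE // normcM normcV ler_pdivrMr; last by rewrite normc_gt0 // subr_eq0.
move/le_trans; apply; rewrite le_eqVlt; apply/orP; left; apply/eqP; field; lra.
Qed.

Lemma close_point a (e : R) : 0 < e -> exists2 b, b != a & normc (b - a) < e.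
Proof.
move=> e0; exists (a + (e / 2)%:C).
  by rewrite -subr_eq0 addrAC subrr add0r; apply/eqP => -[]; lra.
rewrite addrAC subrr add0r normc_real gtr0_norm ?divr_gt0 //; lra.
Qed.

Lemma dquot_bound f a d s M w : 0 < s ->
  (forall w, normc (w - a) < 4 * s -> exists e, is_cderive f w e) ->
  (forall w, normc (w - a) < 4 * s -> normc (f w) <= M) ->
  normc (w - a) < s / 4 -> w != a -> normc (dquot f a d w) <= 16 * M / s.
Proof.
move=> s0 df fM h wa.
have h0 : normc (a - a) < s / 4 by rewrite subrr normc0 divr_gt0.
have cf v : normc (v - a) < 4 * s -> ccont f v.
  by move=> /df[e]; exact: is_cderive_ccont.
have := lipschitz_near [::] f a s M a w s0 cf (fun w h _ => df w h) fM h0 h isT isT.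
by rewrite dquotE // normcM normcV ler_pdivrMr // normc_gt0 // subr_eq0.
Qed.

Lemma cauchy_estimate f a d s M : 0 < s ->
  (forall w, normc (w - a) < 4 * s -> exists e, is_cderive f w e) ->
  (forall w, normc (w - a) < 4 * s -> normc (f w) <= M) ->
  is_cderive f a d -> normc d <= 16 * M / s.
Proof.
move=> s0 df fM fa.
have -> : d = dquot f a d a - 0 by rewrite /dquot eqxx subr0.
apply: le_normc_limit; first exact: dquot_ccont_at.
move=> e e0; have k0 : 0 < Num.min e (s / 4) by rewrite lt_min e0 divr_gt0.
have [b ba] := close_point a _ k0; rewrite lt_min => /andP[h1 h2].
exists b => //; rewrite subr0; apply: le_trans (dquot_bound _ _ _ _ _ _ s0 df fM h2 ba) _.
by rewrite lerDl ltW.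
Qed.

(** The Lipschitz estimate is used a second time, on [dquot f a d], which is bounded by $16M/s$ and
    has the single exceptional point [a]. This yields the constant $16(16M/s)/s=256M/s^2$, and one
    more factor $b-a$ recovers [f]. *)
Lemma taylor_estimate f a d s M b : 0 < s ->
  (forall w, normc (w - a) < 4 * s -> exists e, is_cderive f w e) ->
  (forall w, normc (w - a) < 4 * s -> normc (f w) <= M) ->
  is_cderive f a d -> normc (b - a) < s / 4 ->
  normc (f b - f a - d * (b - a)) <= 256 * M / s ^+ 2 * normc (b - a) ^+ 2.
Proof.
move=> s0 df fM fa hb.
have cf w : normc (w - a) < 4 * s -> ccont f w.
  by move=> /df[e]; exact: is_cderive_ccont.
have M0 : 0 <= M.
  have : normc (a - a) < 4 * s by rewrite subrr normc0 mulr_gt0.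
  by move=> /fM; apply: le_trans; exact: normc_ge0.
have [->|ba] := eqVneq b a.
  by rewrite !subrr mulr0 subrr normc0 expr0n /= mulr0.
have cq w : normc (w - a) < 4 * s -> ccont (dquot f a d) w.
  move=> hw; have [->|wa] := eqVneq w a; first exact: dquot_ccont_at.
  by apply: dquot_ccont => //; exact: cf.
have dq w : normc (w - a) < 4 * s -> w \notin [:: a] ->
    exists e, is_cderive (dquot f a d) w e.
  by rewrite inE => hw wa; apply: dquot_cderive => //; exact: df.
(* Near [a] this is the Lipschitz bound; from distance $s/4$ on, bounding the numerator is
   enough. *)
have qM w : normc (w - a) < 4 * s -> normc (dquot f a d w) <= 16 * M / s.
  move=> hw; have [h|h] := ltP (normc (w - a)) (s / 4).
    have [->|wa] := eqVneq w a; last exact: dquot_bound.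
    by rewrite /dquot eqxx; exact: (cauchy_estimate f a).
  have wa : w != a.
    by apply: contraTneq h => ->; rewrite subrr normc0 -ltNge divr_gt0.
  have h0 : normc (a - a) < 4 * s by rewrite subrr normc0 mulr_gt0.
  rewrite dquotE // normcM normcV ler_pdivrMr; last by lra.
  have k : normc (f w - f a) <= 4 * M.
    have := normcD (f w) (- f a); rewrite normcN.
    by have := fM _ hw; have := fM _ h0; lra.
  apply: le_trans k _.
  have /ler_wpM2l : 0 <= 16 * M / s by rewrite divr_ge0 ?mulr_ge0 // ltW.
  move/(_ _ _ h); apply: le_trans.
  by rewrite le_eqVlt; apply/orP; left; apply/eqP; field; lra.
set L := 256 * M / s ^+ 2.
have L0 : 0 <= L by rewrite divr_ge0 ?mulr_ge0 // ltW // exprn_gt0.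
have key : normc (dquot f a d a - dquot f a d b) <= L * normc (b - a).
  apply: le_normc_limit; first exact: dquot_ccont_at.
  (* [lipschitz_near] excludes the exceptional point [a], so it is applied at a [b'] close to [a];
     [k] makes the excess [L * normc (b' - a)] at most [e]. *)
  move=> e e0; set k := Num.min (Num.min e (s / 4)) (e / (L + 1)).
  have L1 : 0 < L + 1 by lra.
  have k0 : 0 < k by rewrite !lt_min e0 !divr_gt0.
  have [b' b'a] := close_point a _ k0; rewrite !lt_min => /andP[/andP[h1 h2] h3].
  exists b' => //.
  have nb : b \notin [:: a] by rewrite inE.
  have nb' : b' \notin [:: a] by rewrite inE.
  have := lipschitz_near [:: a] _ a s _ _ _ s0 cq dq qM hb h2 nb nb'.
  have -> : 16 * (16 * M / s) / s = L by rewrite /L; field; lra.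
  move/le_trans; apply.
  have := ler_wpM2l L0 (normc_triangle b' a b).
  rewrite (normcB a b) mulrDr.
  move: h3; rewrite ltr_pdivlMr //; have := normc_ge0 (b' - a); lra.
have -> : f b - f a - d * (b - a) = (dquot f a d b - d) * (b - a).
  by rewrite (dquotK f a d b); ring.
rewrite normcM expr2 mulrA.
apply: ler_wpM2r; first exact: normc_ge0.
by rewrite normcB; move: key; rewrite {1}/dquot eqxx.
Qed.

End cauchy_estimates.

(** * Components at the boundary *)

Section components.
Context {R : realType}.
Implicit Types (z w p x eta : R[i]^o) (D Omega Y : set R[i]^o).

Lemma segment_path_connected z w :
  connected [set z + t%:C * (w - z) | t in `[(0 : R), 1]].
Proof.
apply: connected_continuous_connected; first exact: segment_connected.
apply: continuous_subspaceT => t.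
apply/cvgrPdist_lt => e /ball_cplx[d d0 ->].
have n0 : 0 < normc (w - z) + 1 by rewrite ltr_wpDl ?normc_ge0.
rewrite near_simpl; apply/nbhs_ballP; exists (d / (normc (w - z) + 1)) => /=.
  by rewrite divr_gt0.
move=> s; rewrite -ball_normE /ball_ /= ltr_pdivlMr // => h.
rewrite normrcE ltcR.
have -> : z + t%:C * (w - z) - (z + s%:C * (w - z)) = (t - s)%:C * (w - z).
  by rewrite rmorphB /=; ring.
rewrite normcM normc_real; apply: le_lt_trans h.
by apply: ler_wpM2l => //; rewrite lerDl.
Qed.

Lemma ball_connected z (r : R) : 0 < r -> connected (ball z r%:C).
Proof.
move=> r0.
have -> : ball z r%:C = \bigcup_(w in ball z r%:C)
    [set z + t%:C * (w - z) | t in `[(0 : R), 1]].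
  apply/seteqP; split => w; first move=> hw.
    exists w => //; exists 1; first by rewrite /= in_itv /= ler01 lexx.
    by rewrite rmorph1 mul1r addrC subrK.
  move=> [v hv [t]] /=; rewrite in_itv /= => /andP[t0 t1] <-.
  move: hv; rewrite !ball_normcE => hv.
  rewrite (addrC z) addrK normcM normc_real ger0_norm //.
  by apply: le_lt_trans hv; exact: ler_piMl (normc_ge0 _) t1.
apply: bigcup_connected; last by move=> w _; exact: segment_path_connected.
exists z => w _; exists 0; first by rewrite /= in_itv /= ler01 lexx.
by rewrite rmorph0 mul0r addr0.
Qed.

Lemma component_sub D x : connected_component D x `<=` D.
Proof. by move=> y [C [_ CD _] /CD]. Qed.

Lemma component_mem D x : D x -> connected_component D x x.
Proof.
move=> Dx; exists [set x] => //; split => //; last exact: connected1.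
by move=> _ ->.
Qed.

Lemma component_extend D x C : connected C -> C `<=` D ->
  (exists2 y, C y & connected_component D x y) ->
  C `<=` connected_component D x.
Proof.
move=> cC CD [y Cy [A [Ax AD cA] Ay]] z Cz.
exists (A `|` C); last by right.
split; [by left| |].
  by rewrite subUset.
by apply: connectedU => //; exists y.
Qed.

Lemma component_ball D x y (r : R) : 0 < r -> ball y r%:C `<=` D ->
  (exists2 w, ball y r%:C w & connected_component D x w) ->
  ball y r%:C `<=` connected_component D x.
Proof. by move=> r0; apply: component_extend; exact: ball_connected. Qed.

Lemma open_component D x : open D -> open (connected_component D x).
Proof.
move=> /open_normcP oD; apply/open_normcP => y hy.
have [e e0 he] := oD y (component_sub _ _ _ hy).
exists e => // w hw.
apply: (component_ball D x y e e0); last by rewrite ball_normcE.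
  by move=> v; rewrite ball_normcE; exact: he.
by exists y => //; rewrite ball_normcE subrr normc0.
Qed.

(** If the component accumulated at no point of [D] outside [Omega], it would be closed as well as
    open in [D], hence equal to the connected set [D], which is not contained in [Omega]. *)
Lemma edge_point D Omega x : open D -> connected D -> open Omega ->
  ~ D `<=` Omega -> (D `&` Omega) x ->
  exists eta, [/\ D eta, ~ Omega eta & forall e : R, 0 < e ->
    exists2 y, connected_component (D `&` Omega) x y & normc (y - eta) < e].
Proof.
move=> oD cD oO nsub DOx; apply: contrapT => none; apply: nsub.
have oDO : open (D `&` Omega) by exact: openI.
set Y := connected_component (D `&` Omega) x.
have YDO : Y `<=` D `&` Omega by exact: component_sub.
suff <- : Y = D by move=> y /YDO[].
apply: cD.
- by exists x; exact: component_mem.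
- exists Y; first exact: open_component.
  by apply/seteqP; split => [y Yy|y []//]; split => //; case: (YDO y Yy).
exists (closure Y); first exact: closed_closure.
apply/seteqP; split => [y Yy|y [Dy /closure_normcP cy]].
  by split; [case: (YDO y Yy)|exact: subset_closure].
have [Oy|nOy] := pselect (Omega y); last first.
  by exfalso; apply: none; exists y.
have [e e0 he] := (open_normcP _).1 oDO y (conj Dy Oy).
have [w Yw wy] := cy e e0.
apply: (component_ball _ x y e e0).
- by move=> v; rewrite ball_normcE; exact: he.
- by exists w => //; rewrite ball_normcE.
by rewrite ball_normcE subrr normc0.
Qed.

Lemma boundaryP Omega eta : open Omega -> boundary Omega eta <->
  ~ Omega eta /\ forall e : R, 0 < e -> exists2 y, Omega y & normc (y - eta) < e.
Proof.
move=> oO; rewrite /boundary; have /interior_id -> := oO.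
by split => -[h1 h2]; split => //; apply/closure_normcP.
Qed.

Lemma edge_point_boundary D Omega x eta : open Omega -> ~ Omega eta ->
  (forall e : R, 0 < e -> exists2 y,
    connected_component (D `&` Omega) x y & normc (y - eta) < e) ->
  boundary Omega eta.
Proof.
move=> oO nO h; apply/boundaryP => //; split => // e /h[y hy yeta].
by exists y => //; have [] := component_sub _ _ _ hy.
Qed.

Definition rat_point (q : rat * rat) : R[i]^o := ratr q.1 +i* ratr q.2.

Definition rat_disk (j : rat * rat * rat) : set R[i]^o :=
  ball (rat_point j.1) (ratr j.2 : R)%:C.

(** A disk may meet [Omega] in many components; taking that of the centre lets one rational triple
    code both a disk and a component. *)
Definition rat_comp Omega (j : rat * rat * rat) : set R[i]^o :=
  connected_component (rat_disk j `&` Omega) (rat_point j.1).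

Definition rat_adm Omega (j : rat * rat * rat) :=
  [/\ Omega (rat_point j.1), 0 < ratr j.2 :> R & ~ rat_disk j `<=` Omega].

Lemma rat_point_dense z (e : R) : 0 < e -> exists q, normc (rat_point q - z) < e.
Proof.
case: z => a b e0.
have h (t : R) : exists q : rat, `|ratr q - t| < e / 2.
  have lt : t - e / 2 < t + e / 2 by lra.
  have [q] := rat_in_itvoo lt; rewrite in_itv /= => hq.
  by exists q; rewrite ltr_norml; lra.
have [q1 h1] := h a; have [q2 h2] := h b.
exists (q1, q2); apply: le_lt_trans (normc_ReIm ((ratr q1 - a) +i* (ratr q2 - b))) _.
by rewrite /= [e]splitr ltrD.
Qed.

(** The rational centre lies in the component within $e/4$ of [eta], and the radius between $e/4$
    and $e/2$. The disk then contains [eta], so it is not within [Omega], yet it stays in the ball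
    of radius [e]. *)
Lemma rat_comp_exists D Omega x eta (e : R) : open Omega -> 0 < e ->
  ball eta e%:C `<=` D -> ~ Omega eta ->
  (forall r : R, 0 < r -> exists2 y,
    connected_component (D `&` Omega) x y & normc (y - eta) < r) ->
  open D ->
  exists j, [/\ rat_adm Omega j, rat_disk j `<=` ball eta e%:C &
    rat_comp Omega j `<=` connected_component (D `&` Omega) x].
Proof.
move=> oO e0 sub nO near oD.
have e4 : 0 < e / 4 by rewrite divr_gt0.
have [y Yy hy] := near _ e4.
have oY : open (connected_component (D `&` Omega) x).
  by apply: open_component; exact: openI.
have [d d0 hd] := (open_normcP _).1 oY y Yy.
have [q hq] := rat_point_dense y (Num.min d (e / 4 - normc (y - eta)))
  ltac:(by rewrite lt_min d0 subr_gt0).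
move: hq; rewrite lt_min => /andP[/hd Yq hq].
have qeta : normc (rat_point q - eta) < e / 4.
  by have := normc_triangle (rat_point q) y eta; lra.
have lt : e / 4 < e / 2 by lra.
have [k] := rat_in_itvoo lt; rewrite in_itv /= => /andP[k1 k2].
have sub2 : rat_disk (q, k) `<=` ball eta e%:C.
  move=> w; rewrite /rat_disk /= !ball_normcE => hw.
  by have := normc_triangle w (rat_point q) eta; lra.
have [Dq Oq] := component_sub _ _ _ Yq.
have k0 : 0 < ratr k :> R by lra.
exists (q, k); split => //.
  split => //= /(_ eta); rewrite /rat_disk /= ball_normcE normcB => h.
  by apply: nO; apply: h; lra.
apply: component_extend; first exact: component_connected.
  move=> w /component_sub[h1 h2]; split => //.
  by apply: sub; exact: sub2.
exists (rat_point q) => //; apply: component_mem; split => //=.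
by rewrite /rat_disk /= ball_normcE subrr normc0.
Qed.

Lemma rat_disk_edge Omega j : open Omega -> rat_adm Omega j ->
  exists eta, [/\ rat_disk j eta, ~ Omega eta & forall e : R, 0 < e ->
    exists2 y, rat_comp Omega j y & normc (y - eta) < e].
Proof.
move=> oO [Op r0 nsub]; apply: edge_point => //.
- exact: open_ballc.
- exact: ball_connected.
- by split => //; rewrite /rat_disk ball_normcE subrr normc0.
Qed.

End components.

(** * Compactness and Baire's theorem *)

Section ultralimits.
Context {R : realType} {T : Type} (U : set_system T).
Hypothesis UF : UltraFilter U.
Implicit Types (f : R[i]^o -> R[i]^o) (a w : R[i]^o).

Let PF : ProperFilter U := ultra_proper.

(** The limit is the supremum of the [x] that lie below [g] on a set of the ultrafilter; for every
    cut, either the set above it or its complement belongs to [U]. *)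
Lemma ultra_Rlim (g : T -> R) (M : R) : U [set t | `|g t| <= M] ->
  exists l, forall e, 0 < e -> U [set t | `|g t - l| < e].
Proof.
move=> UM; pose E := [set x : R | U [set t | x <= g t]].
have supE : has_sup E.
  split.
    exists (- M); apply: filterS UM => t /=; by rewrite ler_norml => /andP[].
  exists M => x Ex; have [t [/= h1]] := filter_ex (filterI Ex UM).
  by rewrite ler_norml => /andP[_]; exact: le_trans.
exists (sup E) => e e0.
have [x Ex hx] := sup_adherent e0 supE.
have nE : ~ E (sup E + e / 2).
  move=> /(sup_upper_bound supE); rewrite gerDl leNgt => /negP; apply.
  by rewrite divr_gt0.
have [//|UC] := in_ultra_setVsetC [set t | sup E + e / 2 <= g t] UF.
apply: filterS (filterI Ex UC) => t [/= h1 /negP]; rewrite -ltNge => h2.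
rewrite ltr_norml; lra.
Qed.

Lemma ultra_lim (g : T -> R[i]) (M : R) : U [set t | normc (g t) <= M] ->
  exists l, forall e : R, 0 < e -> U [set t | normc (g t - l) < e].
Proof.
move=> UM.
have [x hx] := @ultra_Rlim (fun t => complex.Re (g t)) M
  (filterS (fun t h => le_trans (normc_Re _) h) UM).
have [y hy] := @ultra_Rlim (fun t => complex.Im (g t)) M
  (filterS (fun t h => le_trans (normc_Im _) h) UM).
exists (x +i* y) => e e0; have e2 : 0 < e / 2 by rewrite divr_gt0.
apply: filterS (filterI (hx _ e2) (hy _ e2)) => t [/=].
case: (g t) => u v /= h1 h2.
apply: le_lt_trans (normc_ReIm ((u - x) +i* (v - y))) _.
by rewrite /= [e]splitr ltrD.
Qed.

Lemma ultra_lim_le (g : T -> R[i]) (l c : R[i]) (r : R) :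
  (forall e : R, 0 < e -> U [set t | normc (g t - l) < e]) ->
  U [set t | normc (g t - c) <= r] -> normc (l - c) <= r.
Proof.
move=> hl hr; apply/ler_addgt0Pr => e e0.
have [t [/= h1 h2]] := filter_ex (filterI (hl _ e0) hr).
have := normc_triangle l (g t) c; rewrite (normcB l (g t)); move: h1 h2; lra.
Qed.

(* The second-order Taylor estimate is uniform over a bounded family, so it
   survives any pointwise limit: this replaces Montel's and Weierstrass' theorems. *)
Lemma ultra_lim_cderive (F : T -> R[i]^o -> R[i]^o) f a (s M : R) : 0 < s ->
  U [set t | forall w, normc (w - a) < 4 * s ->
       (exists d, is_cderive (F t) w d) /\ normc (F t w) <= M] ->
  (forall w, normc (w - a) < 4 * s ->
     forall e : R, 0 < e -> U [set t | normc (F t w - f w) < e]) ->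
  exists d, is_cderive f a d.
Proof.
move=> s0 UF0 Ulim.
have aa : normc (a - a) < 4 * s by rewrite subrr normc0 mulr_gt0.
pose D t := derive1 (F t) a.
have UD : U [set t | is_cderive (F t) a (D t)].
  apply: filterS UF0 => t /= h; have [[d hd] _] := h a aa.
  by rewrite /D (is_cderiveE _ _ _ hd).2.
have UD2 : U [set t | normc (D t) <= 16 * M / s].
  apply: filterS (filterI UF0 UD) => t [/= h hd].
  by apply: (cauchy_estimate (F t) a) => // w hw; case: (h w hw).
have [d hd] := ultra_lim D _ UD2.
exists d.
have M0 : 0 <= M.
  have [t /= h] := filter_ex UF0; have [_] := h a aa.
  by apply: le_trans; exact: normc_ge0.
pose L := 256 * M / s ^+ 2.
have L0 : 0 <= L by rewrite divr_ge0 ?mulr_ge0 // ltW // exprn_gt0.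
have key b : normc (b - a) < s / 4 ->
    normc (f b - f a - d * (b - a)) <= L * normc (b - a) ^+ 2.
  move=> hb; apply/ler_addgt0Pr => e e0.
  have n0 : 0 < 2 + normc (b - a) by rewrite ltr_pwDl ?normc_ge0.
  (* The errors at [a], at [b] and in the derivative are at most [k], [k] and [k * normc (b - a)],
     which sum to [e]. *)
  pose k := e / (2 + normc (b - a)).
  have k0 : 0 < k by rewrite divr_gt0.
  have bb : normc (b - a) < 4 * s by lra.
  have [t [/= [h hD] [[k1 k2] k3]]] := filter_ex (filterI (filterI UF0 UD)
    (filterI (filterI (Ulim a aa _ k0) (Ulim b bb _ k0)) (hd _ k0))).
  have := taylor_estimate (F t) a (D t) s M b s0 (fun w hw => (h w hw).1)
    (fun w hw => (h w hw).2) hD hb.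
  rewrite -/L => k4.
  have -> : f b - f a - d * (b - a) =
    (F t b - F t a - D t * (b - a)) - (F t b - f b) + (F t a - f a) +
    (D t - d) * (b - a) by ring.
  have t1 := normcD (F t b - F t a - D t * (b - a)) (- (F t b - f b)).
  have t2 := normcD (F t b - F t a - D t * (b - a) - (F t b - f b)) (F t a - f a).
  have t3 := normcD (F t b - F t a - D t * (b - a) - (F t b - f b) + (F t a - f a))
    ((D t - d) * (b - a)).
  rewrite normcN in t1; rewrite [X in _ <= _ + X]normcM in t3.
  have t4 : normc (D t - d) * normc (b - a) <= k * normc (b - a).
    by apply: ler_wpM2r; [exact: normc_ge0|exact: ltW].
  have -> : e = k + k + k * normc (b - a).
    by rewrite /k; field; lra.
  lra.
move=> e e0.
have L1 : 0 < L + 1 by lra.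
exists (Num.min (s / 4) (e / (L + 1))); first by rewrite lt_min !divr_gt0.
move=> w; rewrite lt_min => /andP[/key h1]; rewrite ltr_pdivlMr // => h2.
apply: le_trans h1 _; rewrite expr2 mulrA; apply: ler_wpM2r; first exact: normc_ge0.
have := normc_ge0 (w - a); lra.
Qed.

End ultralimits.

(** * Neighbourhoods and completeness of the Frechet space *)

Section frechet.
Context {R : realType}.
Implicit Types (Omega V A : set R[i]^o) (K : (set R[i]^o)^nat).
Implicit Types (f h : R[i]^o -> R[i]^o) (z w : R[i]^o).

Lemma exhaustion_mono Omega K m n : exhaustion Omega K -> (m <= n)%N ->
  K m `<=` K n.
Proof.
move=> [_ KS _]; apply: (homo_leq (r := fun A B => A `<=` B)) => //.
- by move=> A.
- by move=> A B C /= h1 h2; exact: subset_trans h1 h2.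
by move=> k; apply: subset_trans (KS k) _; exact: interior_subset.
Qed.

Lemma exhaustion_sub Omega K m : exhaustion Omega K -> K m `<=` Omega.
Proof. by move=> [_ _ <-] z Kz; exists m. Qed.

Lemma exhaustion_near Omega K z : exhaustion Omega K -> Omega z ->
  exists m, exists2 r : R, 0 < r & forall w, normc (w - z) < r -> K m w.
Proof.
move=> [_ KS <-] [m _ /KS Kz]; exists m.+1.
exact: ((nbhs_normcP z (K m.+1)).1 Kz).
Qed.

Lemma holomorphic_cderive Omega f : holomorphic_on Omega f <->
  forall z, Omega z -> exists d, is_cderive f z d.
Proof.
split => h z /h; first by move/derivable_cderive; exists (derive1 f z).
by move=> [d /is_cderiveE[]].
Qed.

Lemma holomorphic_bounded_compact Omega A f : holomorphic_on Omega f ->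
  A `<=` Omega -> compact A -> exists M : R, forall z, A z -> normc (f z) <= M.
Proof.
move=> hf AO cA.
have cg : {within A, continuous (fun z => normc (f z) : R^o)}.
  apply: continuous_in_subspaceT => z /set_mem /AO /hf.
  move/derivable_cderive/is_cderive_ccont => cf.
  have H : (fun z => normc (f z) : R^o) @ nbhs z --> (normc (f z) : R^o).
    apply/cvgrPdist_lt => e e0; have [r r0 hr] := cf e e0.
    rewrite near_simpl; apply/nbhs_normcP; exists r => // w /hr.
    apply: le_lt_trans; rewrite ler_norml.
    have := normcD (f w - f z) (f z); rewrite subrK.
    have := normcD (f z - f w) (f w); rewrite subrK (normcB (f z)).
    lra.
  exact H.
have [M [_ hM]] := compact_bounded (continuous_compact cg cA).
exists (M + 1) => z Az.
apply: le_trans (ler_norm _) _; apply: (hM (M + 1)); first by rewrite ltrDl.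
by exists z.
Qed.

(** The bound [M] is asked for because [sup] takes a default value on unbounded sets. *)
Lemma supnorm_ub A f (M : R) z : (forall z, A z -> normc (f z) <= M) ->
  A z -> normc (f z) <= supnorm A f.
Proof.
move=> hM Az; apply: ub_le_sup; last by exists z.
by exists M => _ [w Aw <-]; exact: hM.
Qed.

Lemma supnorm_le A f (M : R) : 0 <= M -> (forall z, A z -> normc (f z) <= M) ->
  supnorm A f <= M.
Proof.
move=> M0 hM; rewrite /supnorm; set E := [set _ | _ in _].
have [->|/set0P[x Ex]] := eqVneq E set0.
  by rewrite sup0.
by apply: ge_sup; [exists x|move=> _ [w Aw <-]; exact: hM].
Qed.

End frechet.

Section frechet_space.
Context {R : realType} (Omega V : set R[i]^o) (K : (set R[i]^o)^nat).
Hypothesis oV : V `<=` Omega.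
Hypothesis exK : exhaustion Omega K.
Implicit Types f g h : X Omega V K.

(** Unfolds the topology generated by a subbase: an open set is a union of finite intersections of
    seminorm balls, listed here as [D]. *)
Lemma X_openP (A : set (X Omega V K)) : open A -> forall f, A f -> exists D : seq (option nat * X Omega V K * R),
  [/\ (forall j, j \in D -> 0 < j.2), (forall j, j \in D -> @X_ball R Omega V K j f) &
      forall h, (forall j, j \in D -> @X_ball R Omega V K j h) -> A h].
Proof.
move=> oA f Af.
have [D' sD' AE] : exists2 D', D' `<=` finI_from [set j | 0 < j.2] (@X_ball R Omega V K) & \bigcup_(i in D') i = A := oA.
move: Af; rewrite -AE => -[B D'B Bf].
have [F FD FE] := sD' _ D'B.
exists (finmap.enum_fset F); split.
- by move=> j jF; have /set_mem := FD j jF.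
- by move=> j jF; move: Bf; rewrite -FE; apply.
by move=> h hh; exists B => //; rewrite -FE => j /hh.
Qed.
Lemma X_ball_open (j : option nat * X Omega V K * R) : 0 < j.2 -> open (@X_ball R Omega V K j).
Proof.
move=> j0.
have H : exists2 D', D' `<=` finI_from [set j | 0 < j.2] (@X_ball R Omega V K) & \bigcup_(i in D') i = (@X_ball R Omega V K j).
  exists [set @X_ball R Omega V K j]; last by rewrite bigcup_set1.
  move=> _ ->; exists (finmap.fset1 j).
    by move=> k; rewrite finmap.in_fset1 => /eqP ->; exact/mem_set.
  apply/seteqP; split => h; last by move=> hh k /=; rewrite finmap.in_fset1 => /eqP ->.
  by move=> /(_ j) H; apply: H; rewrite /= finmap.in_fset1 eqxx.
exact: H.
Qed.

(** These sets form a neighbourhood base at [f]: one compact set suffices since the [K m] increase.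
    The inequality is not strict, so that it survives pointwise limits. *)
Definition X_cyl (f : X Omega V K) m (e : R) : set (X Omega V K) :=
  [set h | forall z, (V `|` K m) z -> normc (h z - f z) <= e].

Lemma X_bound f m : exists M : R, forall z, (V `|` K m) z -> normc (f z) <= M.
Proof.
have [M1 h1] := (bounded_normcP _ _).1 (X_bounded f).
have [cK _ _] := exK.
have [M2 h2] := holomorphic_bounded_compact Omega _ _ (@X_holomorphic _ _ _ _ f)
  (exhaustion_sub _ _ m exK) (cK m).
exists (Num.max M1 M2) => z [/h1|/h2] h; rewrite le_max h ?orbT //.
Qed.

Lemma X_bound2 f g m : exists M : R,
  forall z, (V `|` K m) z -> normc (f z - g z) <= M.
Proof.
have [M1 h1] := X_bound f m; have [M2 h2] := X_bound g m.
exists (M1 + M2) => z hz; apply: le_trans (normcD _ _) _.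
by rewrite normcN lerD ?h1 ?h2.
Qed.

Definition X_index_set (i : option nat) : set R[i]^o :=
  if i is Some m then K m else V.

Lemma X_seminormE i (f : R[i]^o -> R[i]^o) :
  X_seminorm V K i f = supnorm (X_index_set i) f.
Proof. by case: i. Qed.

Lemma X_index_setS i m : (odflt 0%N i <= m)%N -> X_index_set i `<=` V `|` K m.
Proof.
case: i => [n|] /= h z hz; last by left.
by right; exact: (exhaustion_mono _ _ _ _ exK h).
Qed.

Lemma X_cylS f m n (e d : R) : (m <= n)%N -> d <= e ->
  X_cyl f n d `<=` X_cyl f m e.
Proof.
move=> mn de h hh z hz; apply: le_trans (hh z _) de.
by case: hz => [|hz]; [left|right; exact: (exhaustion_mono _ _ _ _ exK mn)].
Qed.

Lemma X_ball_cyl (j : option nat * X Omega V K * R) f : @X_ball R Omega V K j f ->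
  exists m, exists2 e : R, 0 < e & X_cyl f m e `<=` @X_ball R Omega V K j.
Proof.
case: j => [[i g] r]; rewrite /X_ball /= X_seminormE => hr.
set N := supnorm _ _ in hr.
(* For the seminorm over [V] the index 0 is a dummy. Half of the gap $r-N$ keeps the sum strictly
   below [r]. *)
exists (odflt 0%N i); exists ((r - N) / 2); first by rewrite divr_gt0 // subr_gt0.
move=> h hh; rewrite /= X_seminormE.
have [M hM] := X_bound2 f g (odflt 0%N i).
have sub := X_index_setS i _ (leqnn _).
have N0 : 0 <= N.
  have [E|/set0P[x Ex]] := eqVneq (X_index_set i) set0.
    by rewrite /N /supnorm E image_set0 sup0.
  apply: le_trans (normc_ge0 (f x - g x)) _.
  apply: (@supnorm_ub R _ (fun z => f z - g z) M) => // z /sub; exact: hM.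
have : supnorm (X_index_set i) (fun z => h z - g z) <= (r - N) / 2 + N.
  apply: supnorm_le.
    by rewrite addr_ge0 // divr_ge0 // ltW // subr_gt0.
  move=> z hz; apply: le_trans (normc_triangle _ (f z) _) _.
  apply: lerD; first by apply: hh; exact: sub.
  by apply: (@supnorm_ub R _ (fun z => f z - g z) M) => // w /sub; exact: hM.
move/le_lt_trans; apply; move: hr; clear; move: N => N; lra.
Qed.

(** The largest index and the least radius turn finitely many seminorm balls into one cylinder;
    conversely the balls for [V] and [K m] of radius $e/2$ about [f] intersect inside the
    cylinder. *)
Lemma X_nbhsP f (A : set (X Omega V K)) :
  nbhs f A <-> exists m, exists2 e : R, 0 < e & X_cyl f m e `<=` A.
Proof.
split.
  rewrite nbhsE => -[B [oB Bf] BA].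
  have [D [_ Df DB]] := X_openP B oB f Bf.
  suff [m [e e0 he]] : exists m, exists2 e : R, 0 < e &
      forall h, X_cyl f m e h -> forall j, j \in D -> @X_ball R Omega V K j h.
    by exists m; exists e => // h /he hh; apply: BA; exact: DB.
  elim: D Df {DB} => [|j D IH] Df; first by exists 0%N; exists 1.
  have [m1 [e1 e10 h1]] : exists m, exists2 e : R, 0 < e &
      forall h, X_cyl f m e h -> forall j, j \in D -> @X_ball R Omega V K j h.
    by apply: IH => k kD; apply: Df; rewrite inE kD orbT.
  have [m2 [e2 e20 h2]] := X_ball_cyl j f (Df j (mem_head _ _)).
  exists (maxn m1 m2); exists (Num.min e1 e2); first by rewrite lt_min e10.
  move=> h hh k; rewrite inE => /orP[/eqP ->|].
    by apply: h2; apply: X_cylS hh; [exact: leq_maxr|rewrite ge_min lexx orbT].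
  by apply: h1; apply: X_cylS hh; [exact: leq_maxl|rewrite ge_min lexx].
move=> [m [e e0 he]].
have e20 : 0 < e / 2 by rewrite divr_gt0.
have se (i : option nat) : supnorm (X_index_set i) (fun z => f z - f z) < e / 2.
  apply: le_lt_trans e20; apply: supnorm_le => // z _.
  by rewrite subrr normc0.
have H i : nbhs f (@X_ball R Omega V K (i, f, e / 2)).
  by apply: open_nbhs_nbhs; split; [exact: X_ball_open|rewrite /X_ball /= X_seminormE].
apply: filterS (filterI (H None) (H (Some m))) => h [].
rewrite /X_ball /= => k1 k2; apply: he => z hz.
have [M hM] := X_bound2 h f m.
have ee : e / 2 <= e by rewrite ler_pdivrMr // ler_peMr ?ler1n // ltW.
case: hz => hz.
  apply: le_trans ee; apply: le_trans (ltW k1).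
  apply: (@supnorm_ub R _ (fun z => h z - f z) M) => // w hw; apply: hM; by left.
apply: le_trans ee; apply: le_trans (ltW k2).
apply: (@supnorm_ub R _ (fun z => h z - f z) M) => // w hw; apply: hM; by right.
Qed.

Lemma X_open_cyl (A : set (X Omega V K)) : open A <->
  forall f, A f -> exists m, exists2 e : R, 0 < e & X_cyl f m e `<=` A.
Proof. by rewrite openE; split => h f /h /X_nbhsP. Qed.

Lemma X_cover z : Omega z -> exists m, K m z.
Proof. by case: exK => _ _ <- [m _ Km]; exists m. Qed.

(* The second clause expresses that [f] is a pointwise limit point of [F]. *)
Lemma X_limit_point (F : nat -> X Omega V K) :
  (forall k, exists M : R, forall l, (k <= l)%N -> forall z, (V `|` K k) z ->
     normc (F l z) <= M) ->
  exists f : X Omega V K, forall z (c : R[i]^o) (r : R) N, Omega z ->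
    (forall l, (N <= l)%N -> normc (F l z - c) <= r) -> normc (f z - c) <= r.
Proof.
move=> bF.
(* An ultrafilter finer than the eventual filter picks a limit at every point at once; local
   boundedness is all that is required. *)
have [U [UF sU]] := ultraFilterLemma (eventually_filter : ProperFilter \oo).
have PF : ProperFilter U := ultra_proper.
have evU N (P : nat -> Prop) : (forall l, (N <= l)%N -> P l) -> U [set l | P l].
  by move=> h; apply: sU; exists N => // l /= /h.
have lim z : exists l : R[i], Omega z ->
    forall e : R, 0 < e -> U [set k | normc (F k z - l) < e].
  have [Oz|nOz] := pselect (Omega z); last by exists 0.
  have [m Kz] := X_cover z Oz; have [M hM] := bF m.
  have [|l hl] := @ultra_lim R nat U UF (fun k => F k z) M.
    by apply: (evU m) => l /hM; apply; right.
  by exists l.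
have [f0 hf0] := choice lim.
pose f : R[i]^o -> R[i]^o := fun z => if pselect (Omega z) then f0 z else 0.
have fO z : Omega z -> f z = f0 z by rewrite /f; case: pselect.
have fle z (c : R[i]^o) (r : R) N : Omega z ->
    (forall l, (N <= l)%N -> normc (F l z - c) <= r) -> normc (f z - c) <= r.
  move=> Oz h; rewrite fO //.
  apply: (@ultra_lim_le R nat U UF (fun k => F k z)); first exact: hf0.
  exact: (evU N).
have hol : holomorphic_on Omega f.
  apply/holomorphic_cderive => a Oa.
  have [m [r r0 hr]] := exhaustion_near _ _ _ exK Oa.
  have [M hM] := bF m.
  have r4 : 4 * (r / 4) = r by rewrite mulrC divfK.
  apply: (@ultra_lim_cderive R nat U UF (fun k => F k) f a (r / 4) M).
  - by rewrite divr_gt0.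
  - apply: (evU m) => l ml w; rewrite r4 => /hr Kw.
    split; last by apply: (hM l ml); right.
    have Ow := exhaustion_sub _ _ _ exK _ Kw.
    exact: ((holomorphic_cderive _ _).1 (@X_holomorphic _ _ _ _ (F l)) w Ow).
  move=> w; rewrite r4 => /hr Kw.
  have Ow := exhaustion_sub _ _ _ exK _ Kw.
  by rewrite fO //; exact: hf0.
have bd : [bounded f z | z in V].
  apply/bounded_normcP; have [M hM] := bF 0%N.
  exists M => z Vz; rewrite -[f z]subr0; apply: (fle _ _ _ 0%N); first exact: oV.
  by move=> l l0; rewrite subr0; apply: (hM l l0); left.
have out z : ~ Omega z -> f z = 0 by rewrite /f; case: pselect.
by exists (@MkX R Omega V K f hol bd out).
Qed.

(** The classical nested-ball construction, with cylinders as balls; completeness enters through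
    [X_limit_point]. *)
Lemma X_baire (U : nat -> set (X Omega V K)) : (forall n, open (U n)) ->
  (forall n, dense (U n)) -> dense (\bigcap_n U n).
Proof.
move=> oU dU O [f0 Of0] oO'.
have [m0 [e0 e00 he0]] := (X_open_cyl O).1 oO' f0 Of0.
(* A state is a cylinder, given by centre, index and radius, with its stage number. Each new centre
   lies within half the old radius, and the new radius is at most that half. *)
pose T := (X Omega V K * nat * R * nat)%type.
pose P (s : T) := 0 < s.1.2.
pose Q (s t : T) := let: (f, m, e, k) := s in let: (f', m', e', k') := t in
  [/\ k' = k.+1, (m < m')%N, e' <= e / 2, X_cyl f m (e / 2) f' &
      X_cyl f' m' e' `<=` U k].
have step (s : {s | P s}) : {t : {t | P t} | Q (sval s) (sval t)}.
  apply: cid; case: s => [[[[f m] e] k] Ps].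
  have e2 : 0 < e / 2 by rewrite divr_gt0.
  have nb : nbhs f (X_cyl f m (e / 2)) by apply/X_nbhsP; exists m; exists (e / 2).
  have [|g [Wg Ug]] := dU k (interior (X_cyl f m (e / 2))) _ (open_interior _).
    by exists f.
  have [m' [e' e'0 he']] := (X_open_cyl _).1 (oU k) g Ug.
  have Pt : P (g, maxn m.+1 m', Num.min e' (e / 2), k.+1) by rewrite /P /= lt_min e'0.
  exists (exist (fun s : T => P s) _ Pt); split => //=.
  - by rewrite leq_max leqnn.
  - by rewrite ge_min lexx orbT.
  - exact: (interior_subset Wg).
  apply: subset_trans he'; apply: X_cylS; first exact: leq_maxr.
  by rewrite ge_min lexx.
have P0 : P (f0, m0, e0, 0%N) by [].
have [S [S0 SS]] := dependent_choice step (exist (fun s : T => P s) _ P0).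
pose F n := (sval (S n)).1.1.1; pose m n := (sval (S n)).1.1.2.
pose e n := (sval (S n)).1.2.
have Sn n : sval (S n) = (F n, m n, e n, n).
  rewrite /F /m /e; elim: n => [|n]; first by rewrite S0.
  move: (SS n); case: (sval (S n)) => [[[f a] b] k].
  by case: (sval (S n.+1)) => [[[f' a'] b'] k'] /= [-> _ _ _ _] [->].
have e_gt0 n : 0 < e n by exact: (svalP (S n)).
have QS n : Q (F n, m n, e n, n) (F n.+1, m n.+1, e n.+1, n.+1) by rewrite -!Sn.
have mS n : (m n < m n.+1)%N by case: (QS n).
have eS n : e n.+1 <= e n / 2 by case: (QS n).
have FS n : X_cyl (F n) (m n) (e n / 2) (F n.+1) by case: (QS n).
have US n : X_cyl (F n.+1) (m n.+1) (e n.+1) `<=` U n by case: (QS n).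
have mm k l : (k <= l)%N -> (m k <= m l)%N.
  by apply: (homo_leq (r := leq)) => [//|x y z|i]; [exact: leq_trans|exact: ltnW].
(* Puts [K k] inside [K (m k)], so that the cylinder of stage [k] gives the bound on [K k] required
   by [X_limit_point]. *)
have mk k : (k <= m k)%N.
  by elim: k => // k IH; apply: leq_ltn_trans IH (mS k).
(* The radius [e k - e l] absorbs each new displacement, since $e_l/2\le e_l-e_{l+1}$. *)
have near k l : (k <= l)%N -> X_cyl (F k) (m k) (e k - e l) (F l).
  elim: l => [|l IH].
    by rewrite leqn0 => /eqP -> z _; rewrite !subrr normc0.
  rewrite leq_eqVlt => /orP[/eqP -> z _|]; first by rewrite !subrr normc0.
  rewrite ltnS => kl z hz; apply: le_trans (normc_triangle _ (F l z) _) _.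
  have h1 := IH kl z hz.
  have h2 : normc (F l.+1 z - F l z) <= e l / 2.
    apply: FS; case: hz => hz; [by left|right].
    exact: (exhaustion_mono _ _ _ _ exK (mm _ _ kl)).
  move: h1 h2 (eS l) (e_gt0 l.+1); move: (normc _) (normc _) (e l) (e k) (e l.+1).
  move=> a b c d u; lra.
have [f hf] : exists f : X Omega V K, forall z (c : R[i]^o) (r : R) N, Omega z ->
    (forall l, (N <= l)%N -> normc (F l z - c) <= r) -> normc (f z - c) <= r.
  apply: X_limit_point => k; have [M hM] := X_bound (F k) k.
  exists (e k + M) => l kl z hz.
  have -> : F l z = (F l z - F k z) + F k z by rewrite subrK.
  apply: le_trans (normcD _ _) _; apply: lerD; last exact: hM.
  have hz' : (V `|` K (m k)) z.
    by case: hz => hz; [left|right; exact: (exhaustion_mono _ _ _ _ exK (mk k))].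
  by apply: le_trans (near k l kl z hz') _; rewrite gerBl ltW.
have fk k : X_cyl (F k) (m k) (e k) f.
  move=> z hz; apply: (hf _ _ _ k).
    by case: hz => [/oV //|]; exact: (exhaustion_sub _ _ _ exK).
  by move=> l kl; apply: le_trans (near k l kl z hz) _; rewrite gerBl ltW.
exists f; split; last by move=> n _; apply: US; exact: fk.
apply: he0; have := fk 0%N.
by rewrite /F /m /e S0.
Qed.

End frechet_space.

Arguments X_cyl {R Omega V K}.
Arguments X_bound {R Omega V K}.
Arguments X_cover {R Omega K}.
Arguments X_open_cyl {R Omega V K}.
Arguments X_baire {R Omega V K}.

(** * Functions whose derivative blows up *)

Section square_root.
Context {R : realType}.
Implicit Types (w v z : R[i]^o).

(** The root in the closed right half-plane, whichever sign [sqrtc] takes. *)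
Definition csqrt w : R[i]^o :=
  if 0 < complex.Re (sqrtc w) then sqrtc w else - sqrtc w.

Lemma csqrtK w : csqrt w ^+ 2 = w.
Proof. by rewrite /csqrt; case: ifP => _; rewrite ?sqrrN sqr_sqrtc. Qed.

Lemma Re_csqrt_ge0 w : 0 <= complex.Re (csqrt w).
Proof.
rewrite /csqrt; case: ltP => [/ltW //|].
by case: (sqrtc w) => a b /=; rewrite oppr_ge0.
Qed.

(** A root with zero real part is $ib$ with $b$ real, and its square is $-b^2$. *)
Lemma Re_csqrt_gt0 w : ~ (exists2 t : R, 0 <= t & w = (- t)%:C) ->
  0 < complex.Re (csqrt w).
Proof.
move=> hw; rewrite lt_def Re_csqrt_ge0 andbT; apply: contra_notN hw => /eqP.
have := csqrtK w; case: (csqrt w) => a b E /= a0; move: E; rewrite a0 => <-.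
exists (b ^+ 2); first exact: sqr_ge0.
by rewrite expr2 /real_complex_def; apply/eqP; rewrite eq_complex /=;
  apply/andP; split; apply/eqP; ring.
Qed.

(** A difference of squares, divided by a sum with positive real part. The identity yields both the
    continuity and the derivative of the root. *)
Lemma csqrtB v w : 0 < complex.Re (csqrt w) ->
  csqrt v - csqrt w = (csqrt v + csqrt w)^-1 * (v - w).
Proof.
move=> w0; have S0 : csqrt v + csqrt w != 0.
  apply/eqP => E; have := Re_csqrt_ge0 v; have := congr1 (@complex.Re R) E.
  by move: w0; case: (csqrt v) => a b; case: (csqrt w) => c d /=; lra.
have -> : v - w = csqrt v ^+ 2 - csqrt w ^+ 2 by rewrite !csqrtK.
by field.
Qed.

Lemma csqrt_ccont w : 0 < complex.Re (csqrt w) -> ccont csqrt w.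
Proof.
move=> w0 e e0; exists (e * complex.Re (csqrt w)); first by rewrite mulr_gt0.
move=> v hv; rewrite csqrtB // normcM normcV mulrC.
have S0 : complex.Re (csqrt w) <= normc (csqrt v + csqrt w).
  apply: le_trans (normc_Re _); apply: le_trans (ler_norm _).
  by have := Re_csqrt_ge0 v; case: (csqrt v) => a b; case: (csqrt w) => c d /=; lra.
rewrite ltr_pdivrMr; last exact: lt_le_trans w0 S0.
by apply: lt_le_trans hv _; rewrite ler_pM2l.
Qed.

Lemma csqrt_cderive w : 0 < complex.Re (csqrt w) ->
  is_cderive csqrt w (csqrt w + csqrt w)^-1.
Proof.
move=> w0; apply/is_cderiveP; exists (fun v => (csqrt v + csqrt w)^-1).
  split => //; apply: ccontV.
    apply/eqP => E; have := congr1 (@complex.Re R) E.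
    by move: w0; case: (csqrt w) => c d /=; lra.
  have -> : (fun v => csqrt v + csqrt w) = (fun v => csqrt v - (- csqrt w)).
    by apply/funext => v; rewrite opprK.
  by apply: ccontB; [exact: csqrt_ccont|exact: ccont_cst].
by exists 1 => // v _; exact: csqrtB.
Qed.

Lemma is_cderive_comp (f g : R[i]^o -> R[i]^o) z (c d : R[i]^o) :
  is_cderive g z d -> is_cderive f (g z) c ->
  is_cderive (fun w => f (g w)) z (c * d).
Proof.
move=> hg /is_cderiveP[p [pz cp] [r r0 hr]].
have cg := is_cderive_ccont _ _ _ hg.
move/is_cderiveP: hg => [q [qz cq] [s s0 hs]].
have [u u0 hu] := cg r r0.
apply/is_cderiveP; exists (fun w => p (g w) * q w).
  rewrite pz qz; split => //; apply: ccontM => // e /cp[t t0 ht].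
  by have [k k0 hk] := cg t t0; exists k => // w /hk /ht.
exists (Num.min s u); first by rewrite lt_min s0.
by move=> w; rewrite lt_min => /andP[/hs k1 /hu k2]; rewrite hr // k1 mulrA.
Qed.

End square_root.

Section witness.
Context {R : realType} (Omega V : set R[i]^o) (K : (set R[i]^o)^nat).
Implicit Types (a b z w : R[i]^o).

Lemma X_of_cderive (g g' : R[i]^o -> R[i]^o) : open Omega -> V `<=` Omega ->
  (forall z, Omega z -> is_cderive g z (g' z)) ->
  (exists M : R, forall z, V z -> normc (g z) <= M) ->
  exists f : X Omega V K, forall z, Omega z -> derive1 f z = g' z.
Proof.
move=> oO VO dg [M hM].
pose f : R[i]^o -> R[i]^o := fun z => if pselect (Omega z) then g z else 0.
have fO z : Omega z -> f z = g z by rewrite /f; case: pselect.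
have df z : Omega z -> is_cderive f z (g' z).
  move=> Oz; have [r r0 hr] := (open_normcP _).1 oO z Oz.
  by apply: is_cderive_near_eq r0 _ (dg z Oz) => w /hr /fO ->.
have hol : holomorphic_on Omega f.
  by apply/holomorphic_cderive => z /df h; exists (g' z).
have bd : [bounded f z | z in V].
  by apply/bounded_normcP; exists M => z Vz; rewrite fO; [exact: hM|exact: VO].
have out z : ~ Omega z -> f z = 0 by rewrite /f; case: pselect.
exists (@MkX R Omega V K f hol bd out) => z /df.
by move/is_cderiveE => [].
Qed.

Lemma is_cderive_sub z c : is_cderive (fun w => w - c) z (1 : R[i]).
Proof.
by rewrite -[1]addr0; apply: is_cderiveD; [exact: is_cderive_id|exact: is_cderive_cst].
Qed.

(** Divergence on the whole of [Omega] near [a], so that it is seen from every component that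
    accumulates at [a]. *)
Definition blows_up (g' : R[i]^o -> R[i]^o) a := forall M : R,
  exists2 d : R, 0 < d & forall z, Omega z -> normc (z - a) < d ->
    M < normc (g' z).

(** Since [V] keeps a distance [e] from [a], the function $1/(z-a)$ is bounded by $1/e$ on [V],
    while its derivative has modulus $|z-a|^{-2}$. *)
Lemma witness_off_closure a : open Omega -> V `<=` Omega -> ~ Omega a ->
  ~ closure V a -> exists f : X Omega V K, blows_up (derive1 f) a.
Proof.
move=> oO VO nO ncl.
have [e e0 he] : exists2 e : R, 0 < e & forall z, V z -> e <= normc (z - a).
  apply: contrapT => h; apply: ncl; apply/closure_normcP => e e0.
  apply: contrapT => h'; apply: h; exists e => // z Vz.
  by rewrite leNgt; apply/negP => hz; apply: h'; exists z.
have ne z : Omega z -> z - a != 0.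
  by move=> Oz; rewrite subr_eq0; apply/eqP => E; apply: nO; rewrite -E.
have [||f hf] := X_of_cderive (fun z => (z - a)^-1) (fun z => - 1 / (z - a) ^+ 2) oO VO.
- move=> z /ne za; apply: (@is_cderiveV R (fun v => v - a)) => //.
  exact: is_cderive_sub.
- exists e^-1 => z Vz; rewrite normcV lef_pV2 ?posrE //; first exact: he.
  by apply: lt_le_trans e0 (he z Vz).
exists f => M; pose N := `|M| + 1.
have N0 : 0 < N by rewrite ltr_wpDl.
exists (Num.min 1 N^-1); first by rewrite lt_min ltr01 invr_gt0.
move=> z Oz; rewrite lt_min hf // => /andP[h1 h2].
rewrite normcM normcN normc1 mul1r normcV expr2 normcM.
have n0 := normc_gt0 _ (ne z Oz); move: h1 h2 n0; move: (normc (z - a)) => x h1 h2 x0.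
apply: lt_le_trans (_ : N <= _); first by rewrite /N; have := ler_norm M; lra.
rewrite -[N]invrK lef_pV2 ?posrE ?mulr_gt0 ?invr_gt0 //.
by apply: le_trans (ltW h2); rewrite ger_pMl // ltW.
Qed.

(** With $s=\sqrt{(z-a)/(z-b)}$, the derivative of $1/(1+s)$ carries the factor $1/(2s)$, which
    blows up as $s\to0$ at [a]; the function itself is bounded because $\mathrm{Re}\,s\ge0$. *)
Lemma witness_segment a b : open Omega -> V `<=` Omega -> ~ Omega a ->
  ~ Omega b -> b <> a -> segment a b `<=` ~` Omega ->
  exists f : X Omega V K, blows_up (derive1 f) a.
Proof.
move=> oO VO nOa nOb ba seg.
have na z : Omega z -> z - a != 0.
  by move=> Oz; rewrite subr_eq0; apply/eqP => E; apply: nOa; rewrite -E.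
have nb z : Omega z -> z - b != 0.
  by move=> Oz; rewrite subr_eq0; apply/eqP => E; apply: nOb; rewrite -E.
pose q z := (z - a) * (z - b)^-1.
(* From $(z-a)/(z-b)=-t$ with $t\ge0$ follows $z=(a+tb)/(1+t)$, the point of the segment with
   parameter $t/(1+t)$, which is not in [Omega]. *)
have slit z : Omega z -> 0 < complex.Re (csqrt (q z)).
  move=> Oz; apply: Re_csqrt_gt0 => -[t t0 E]; suff H : segment a b z by exact: seg z H Oz.
  have t1 : 0 < 1 + t by rewrite ltr_pwDl.
  exists (t / (1 + t)).
    rewrite /= in_itv /=; apply/andP; split; first by rewrite divr_ge0 // ltW.
    by rewrite ler_pdivrMr // mul1r lerDr.
  have t1' : (1 + t)%:C != 0 :> R[i] by apply/eqP => -[]; lra.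
  have E2 : z - a = (- t)%:C * (z - b).
    by rewrite -E /q divfK //; exact: nb.
  apply: (@mulfI R[i] _ t1').
  have -> : (1 + t)%:C * z = a + t%:C * b.
    rewrite rmorphD rmorph1 mulrDl mul1r.
    have -> : z + t%:C * z = (z - a) + a + t%:C * z by rewrite subrK.
    by rewrite E2 rmorphN /=; ring.
  rewrite rmorphB rmorph1 fmorph_div /= rmorphD rmorph1.
  have t2 : 1 + t%:C != 0 :> R[i].
    by move: t1'; rewrite rmorphD rmorph1.
  by field.
pose s z := csqrt (q z).
have s1 z : 1 <= normc (1 + s z).
  apply: le_trans (normc_Re _); apply: le_trans (ler_norm _).
  by have := Re_csqrt_ge0 (q z); rewrite /s; case: csqrt => x y /=; lra.
have s10 z : 1 + s z != 0.
  by apply/eqP => E; have := s1 z; rewrite E normc0; lra.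
have s0 z : Omega z -> s z != 0.
  by move=> /slit h; apply/eqP => E; move: h; rewrite -/(s z) E ltxx.
pose g' z := - ((s z + s z)^-1 * ((a - b) / (z - b) ^+ 2)) / (1 + s z) ^+ 2.
have [||f hf] := X_of_cderive (fun z => (1 + s z)^-1) g' oO VO.
- move=> z Oz; apply: is_cderiveV => //.
  rewrite -[X in is_cderive _ _ X]add0r; apply: is_cderiveD; first exact: is_cderive_cst.
  apply: is_cderive_comp; last exact: csqrt_cderive (slit z Oz).
  have -> : (a - b) / (z - b) ^+ 2 = 1 * (z - b)^-1 + (z - a) * (- 1 / (z - b) ^+ 2).
    by have := nb z Oz => h; field.
  apply: is_cderiveM; first exact: is_cderive_sub.
  by apply: is_cderiveV; [exact: nb|exact: is_cderive_sub].
- exists 1 => z _; rewrite normcV invf_le1 //; exact: lt_le_trans ltr01 (s1 z).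
pose L := normc (a - b).
have L0 : 0 < L by rewrite normc_gt0 // subr_eq0; apply/eqP => /esym.
exists f => M; pose N := `|M| + 1.
have N0 : 0 < N by rewrite ltr_wpDl.
(* Near [a], $|z-b|\le\frac32L$ and $|1+s|\le2$, so the derivative is at least
   $L/(2|s|\cdot\frac94L^2\cdot4)=1/(18L|s|)$, which exceeds [N] once $|s|<k$. The radius below
   forces this, as $|s|^2=|z-a|/|z-b|$ and $|z-b|\ge L/2$. *)
pose k := (18 * L * N)^-1.
have k0 : 0 < k by rewrite invr_gt0 !mulr_gt0.
exists (Num.min (L / 2) (L / 2 * k ^+ 2)).
  by rewrite lt_min !(divr_gt0, mulr_gt0) ?exprn_gt0.
move=> z Oz; rewrite lt_min hf // => /andP[h1 h2].
have b1 : L / 2 <= normc (z - b).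
  by have := normc_triangle a z b; rewrite (normcB a z) -/L; lra.
have b2 : normc (z - b) <= 3 / 2 * L.
  by have := normc_triangle z a b; rewrite -/L; lra.
have b0 : 0 < normc (z - b) by lra.
have sq : normc (s z) ^+ 2 * normc (z - b) = normc (z - a).
  rewrite expr2 -!normcM -expr2 csqrtK /q divfK //; exact: nb.
have sp : 0 < normc (s z) by rewrite normc_gt0 // s0.
have sk : normc (s z) < k.
  rewrite -(ltr_pXn2r (n := 2)) ?nnegrE ?ltW //.
  rewrite -(ltr_pM2r b0) sq; apply: lt_le_trans h2 _.
  by rewrite mulrC; apply: ler_wpM2l => //; rewrite exprn_ge0 // ltW.
have sl1 : normc (s z) <= 1.
  rewrite -(ler_pXn2r (n := 2)) ?nnegrE ?normc_ge0 // expr1n.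
  by rewrite -(ler_pM2r b0) sq mul1r; lra.
have s2 : normc (1 + s z) <= 2 by have := normcD 1 (s z); rewrite normc1; lra.
have E : normc (g' z) = L / (2 * normc (s z) * normc (z - b) ^+ 2 * normc (1 + s z) ^+ 2).
  have ss : normc (s z + s z) = 2 * normc (s z).
    by rewrite -mulr2n normcMn mulr_natl.
  rewrite /g' !(normcM, normcN, normcV, expr2) -/L ss.
  have := s1 z; move: sp b0; move: (normc (s z)) (normc (z - b)) (normc (1 + s z)).
  move=> x y u x0 y0 /(lt_le_trans ltr01) u0.
  by field; rewrite !gt_eqF.
rewrite E ltr_pdivlMr; last first.
  by rewrite !mulr_gt0 ?exprn_gt0 // (lt_le_trans ltr01 (s1 z)).
have MN : M <= N by have := ler_norm M; rewrite /N; lra.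
have yL : normc (z - b) ^+ 2 <= (3 / 2 * L) ^+ 2.
  by rewrite ler_pXn2r ?nnegrE ?mulr_ge0 ?normc_ge0.
have u4 : normc (1 + s z) ^+ 2 <= 2 ^+ 2 by rewrite ler_pXn2r ?nnegrE ?normc_ge0.
set D := 2 * _ * _ * _.
have D0 : 0 <= D by rewrite /D !mulr_ge0 ?exprn_ge0 ?normc_ge0.
have D1 : D <= 2 * normc (s z) * (3 / 2 * L) ^+ 2 * 2 ^+ 2.
  apply: ler_pM => //; rewrite ?mulr_ge0 ?exprn_ge0 ?normc_ge0 //.
  by apply: ler_wpM2l; rewrite ?mulr_ge0 ?normc_ge0.
have D2 : D < 18 * L ^+ 2 * k.
  apply: le_lt_trans D1 _.
  have -> : 2 * normc (s z) * (3 / 2 * L) ^+ 2 * 2 ^+ 2 = 18 * L ^+ 2 * normc (s z).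
    by field.
  by rewrite ltr_pM2l // mulr_gt0 // exprn_gt0.
apply: le_lt_trans (ler_wpM2r D0 MN) _.
have -> : L = N * (18 * L ^+ 2 * k) by rewrite /k; field; rewrite !gt_eqF.
by rewrite ltr_pM2l.
Qed.

End witness.

(** * Generic functions *)

Section generic_functions.
Context {R : realType} (Omega V : set R[i]^o) (K : (set R[i]^o)^nat).
Hypothesis oO : open Omega.
Hypothesis VO : V `<=` Omega.
Hypothesis exK : exhaustion Omega K.
Implicit Types (f g h : X Omega V K) (z w : R[i]^o) (j : rat * rat * rat).

Lemma X_cderive f z : Omega z -> is_cderive f z (derive1 f z).
Proof. by move=> /(@X_holomorphic _ _ _ _ f) /derivable_cderive. Qed.

Lemma is_cderive_axpy (f g : R[i]^o -> R[i]^o) (c a b z : R[i]^o) :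
  is_cderive f z a -> is_cderive g z b ->
  is_cderive (fun w => f w + c * g w) z (a + c * b).
Proof.
move=> hf hg; apply: is_cderiveD => //.
rewrite -[c * b]add0r -(mul0r (g z)); apply: is_cderiveM => //.
exact: is_cderive_cst.
Qed.

Lemma X_axpy f g (c : R[i]^o) : exists h, forall z, h z = f z + c * g z.
Proof.
pose h : R[i]^o -> R[i]^o := fun z => f z + c * g z.
have hol : holomorphic_on Omega h.
  apply/holomorphic_cderive => z Oz; eexists.
  by apply: is_cderive_axpy; exact: X_cderive.
have bd : [bounded h z | z in V].
  apply/bounded_normcP.
  have [M1 h1] := (bounded_normcP _ _).1 (@X_bounded _ _ _ _ f).
  have [M2 h2] := (bounded_normcP _ _).1 (@X_bounded _ _ _ _ g).
  exists (M1 + normc c * M2) => z Vz; apply: le_trans (normcD _ _) _.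
  rewrite normcM; apply: lerD; first exact: h1.
  by apply: ler_wpM2l; [exact: normc_ge0|exact: h2].
have out z : ~ Omega z -> h z = 0.
  by move=> nO; rewrite /h !X_out // mulr0 addr0.
by exists (@MkX R Omega V K h hol bd out).
Qed.

(** Cauchy's estimate for $h-f$: evaluating the derivative at a point is continuous on the space. *)
Lemma derive1_near z : Omega z -> exists m, exists2 C : R, 0 < C &
  forall f h (e : R), X_cyl f m e h -> normc (derive1 h z - derive1 f z) <= C * e.
Proof.
move=> Oz; have [m [r r0 hr]] := exhaustion_near _ _ _ exK Oz.
exists m; exists (16 / (r / 4)); first by rewrite !divr_gt0.
move=> f h e hh; have r4 : 4 * (r / 4) = r by rewrite mulrC divfK.
have -> : 16 / (r / 4) * e = 16 * e / (r / 4) by rewrite mulrAC.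
have Ow w : normc (w - z) < 4 * (r / 4) -> K m w by rewrite r4; exact: hr.
apply: (cauchy_estimate (fun w => h w + -1 * f w) z); first by rewrite divr_gt0.
- move=> w /Ow /(exhaustion_sub _ _ _ exK) hw; eexists.
  by apply: is_cderive_axpy; exact: X_cderive.
- by move=> w /Ow Kw; rewrite mulN1r; apply: hh; right.
- have -> : derive1 h z - derive1 f z = derive1 h z + -1 * derive1 f z.
    by rewrite mulN1r.
  by apply: is_cderive_axpy; exact: X_cderive.
Qed.

(** An inadmissible triple gives the whole space, so the index can range over all triples. *)
Definition large_derivative j (n : nat) : set (X Omega V K) :=
  [set f : X Omega V K | rat_adm Omega j ->
    exists2 z, rat_comp Omega j z & n%:R < normc (derive1 f z)].

Lemma large_derivative_open j n : open (large_derivative j n).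
Proof.
apply/(X_open_cyl exK) => f hf.
have [adm|nadm] := pselect (rat_adm Omega j); last first.
  exists 0%N; exists 1; first exact: ltr01.
  by move=> h _ /nadm.
have [z Yz hz] := hf adm.
have [m [C C0 hC]] := derive1_near z (component_sub _ _ _ Yz).2.
pose e := (normc (derive1 f z) - n%:R) / 2 / C.
have e0 : 0 < e by rewrite !divr_gt0 // subr_gt0.
exists m; exists e; first exact: e0.
move=> h hh _; exists z; first exact: Yz.
have := hC f h e hh.
have -> : C * e = (normc (derive1 f z) - n%:R) / 2 by rewrite mulrC divfK // gt_eqF.
have := normc_le_near (derive1 f z) (derive1 h z); move: hz.
move: (derive1 f z) (derive1 h z) => a b; lra.
Qed.

Lemma large_derivative_dense j n :
  (forall z, boundary Omega z -> exists f : X Omega V K, blows_up Omega (derive1 f) z) ->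
  dense (large_derivative j n).
Proof.
move=> wit O [f Of] oO'.
have [m [e e0 he]] := (X_open_cyl exK O).1 oO' f Of.
have [adm|nadm] := pselect (rat_adm Omega j); last by exists f; split => // /nadm.
have [[z [Yz hz]]|small] := pselect (exists z, rat_comp Omega j z /\ n%:R < normc (derive1 f z)).
  by exists f; split => // _; exists z.
have [eta [Deta nO near]] := rat_disk_edge _ _ oO adm.
have [g hg] := wit eta (edge_point_boundary _ _ _ _ oO nO near).
have [B hB] := X_bound exK g m.
pose N := `|B| + 1.
have N0 : 0 < N by rewrite ltr_wpDl.
(* This factor keeps $f+cg$ in the cylinder of radius [e] about [f]. *)
pose c := e / N.
have c0 : 0 < c by rewrite divr_gt0.
(* As $|f'|\le n$ on the component, $c|g'|>2n+1$ leaves $|f'+cg'|>n+1$. *)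
have [d d0 hd] := hg ((2 * n%:R + 1) / c).
have [z Yz hz] := near d d0.
have Oz := (component_sub _ _ _ Yz).2.
have [h hh] := X_axpy f g c%:C.
exists h; split.
  apply: he => w hw; rewrite hh addrAC subrr add0r normcM normc_real gtr0_norm //.
  apply: le_trans (_ : c * N <= _); last by rewrite divfK // gt_eqF.
  apply: ler_wpM2l; first exact: ltW.
  apply: le_trans (hB w hw) _; apply: le_trans (ler_norm _) _.
  by rewrite lerDl.
move=> _; exists z => //.
have -> : derive1 h z = derive1 f z + c%:C * derive1 g z.
  apply: (is_cderive_unique _ _ _ _ (X_cderive h z Oz)).
  have -> : (h : R[i]^o -> R[i]^o) = (fun z => f z + c%:C * g z) by exact/funext.
  by apply: is_cderive_axpy; exact: X_cderive.
have fz : normc (derive1 f z) <= n%:R.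
  by rewrite leNgt; apply/negP => h'; apply: small; exists z.
have gz : 2 * n%:R + 1 < c * normc (derive1 g z).
  by have := hd z Oz hz; rewrite ltr_pdivrMr // [_ * c]mulrC.
have cgz : normc (c%:C * derive1 g z) = c * normc (derive1 g z).
  by rewrite normcM normc_real gtr0_norm.
have := normc_le_near (c%:C * derive1 g z) (derive1 f z + c%:C * derive1 g z).
rewrite addrK cgz; move: fz gz.
move: (derive1 f z) (derive1 g z) => a b; move: (c%:C) => u; lra.
Qed.

(** Forward, a small disk about an edge point of the rational component has a component inside it.
    Backward, every component in a disk about a boundary point contains a whole rational
    component. *)
Lemma totally_unboundedE f : totally_unbounded Omega (derive1 f) <->
  forall j n, large_derivative j n f.
Proof.
split.
  move=> TU j n adm; have [eta [Deta nO near]] := rat_disk_edge _ _ oO adm.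
  have [e e0 he] := (open_normcP _).1 (open_ballc _ _) eta Deta.
  have [y Yy hy] := near e e0.
  have Oy := (component_sub _ _ _ Yy).2.
  have By : (ball eta e%:C `&` Omega) y by split => //; rewrite ball_normcE.
  apply: contrapT => small.
  apply: (TU eta e (edge_point_boundary _ _ _ _ oO nO near) e0 _ (ex_intro2 _ _ y By erefl)).
  apply/bounded_normcP; exists n%:R => z Yz.
  rewrite leNgt; apply/negP => hz; apply: small; exists z => //.
  apply: (component_extend _ _ _ (@component_connected _ _ y)) Yz.
    move=> w /component_sub[]; rewrite ball_normcE => /he.
    by split.
  by exists y => //; exact: component_mem.
move=> LD zeta e bz e0 Y [x Dx ->] /bounded_normcP[M hM].
have [nOz _] := (boundaryP _ _ oO).1 bz.
have [|eta [Deta nO near]] := edge_point _ _ x (open_ballc zeta e)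
    (ball_connected zeta e e0) oO _ Dx.
  by move=> /(_ zeta); rewrite ball_normcE subrr normc0 => /(_ e0).
have [e' e'0 he'] := (open_normcP _).1 (open_ballc _ _) eta Deta.
have [|j [adm _ sub]] := rat_comp_exists _ _ x eta e' oO e'0 _ nO near (open_ballc _ _).
  by move=> w; rewrite ball_normcE; exact: he'.
have [z Yz] := LD j (Num.bound `|M|) adm.
apply/negP; rewrite -leNgt; apply: le_trans (hM z (sub z Yz)) _.
apply: le_trans (ler_norm M) _; apply: ltW; exact: archi_boundP.
Qed.

(** The component [Y] need not accumulate at the given boundary point, so an edge point of [Y] in
    [U] takes its place. Continuity bounds [F] near it, and Cauchy's estimate bounds $F'$ on the
    half disk. *)
Lemma extension_near (U Y : set R[i]^o) (F : R[i]^o -> R[i]^o) :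
  domain U -> boundary Omega `&` U !=set0 -> holomorphic_on U F ->
  is_component Y (U `&` Omega) ->
  exists eta (r M : R), [/\ 0 < r /\ ~ Omega eta,
    ball eta r%:C `<=` U,
    forall e : R, 0 < e -> exists2 y, Y y & normc (y - eta) < e,
    forall z, ball eta r%:C z -> normc (F z) <= M &
    forall z, ball eta (r / 2)%:C z -> normc (derive1 F z) <= 16 * M / (r / 8)].
Proof.
move=> [oU _ cU] [zeta [bz Uz]] hF [x Dx ->].
have [nOz _] := (boundaryP _ _ oO).1 bz.
have [|eta [Ueta nO near]] := edge_point _ _ x oU cU oO _ Dx.
  by move=> /(_ zeta Uz).
have dF := (holomorphic_cderive _ _).1 hF.
have [d /is_cderive_ccont cF] := dF eta Ueta.
have [r1 r10 h1] := cF 1 ltr01.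
have [r2 r20 h2] := (open_normcP _).1 oU eta Ueta.
pose r := Num.min r1 r2.
have r0 : 0 < r by rewrite lt_min r10.
have sub w : normc (w - eta) < r -> U w.
  by rewrite lt_min => /andP[_]; exact: h2.
have bF w : normc (w - eta) < r -> normc (F w) <= normc (F eta) + 1.
  rewrite lt_min => /andP[/h1 + _].
  have := normcD (F w - F eta) (F eta); rewrite subrK.
  move: (normc _) (normc _) (normc _) => a b c; lra.
exists eta, r, (normc (F eta) + 1); split => //.
- by move=> w; rewrite ball_normcE; exact: sub.
- by move=> w; rewrite ball_normcE; exact: bF.
move=> z; rewrite ball_normcE => hz.
have near2 w : normc (w - z) < 4 * (r / 8) -> normc (w - eta) < r.
  by have := normc_triangle w z eta; lra.
apply: (cauchy_estimate F z); first by rewrite divr_gt0.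
- by move=> w /near2 /sub; exact: dF.
- by move=> w /near2; exact: bF.
have Uz' : U z by apply: sub; apply: lt_trans hz _; lra.
exact: derivable_cderive (hF z Uz').
Qed.

(** Near the edge point $f'$ coincides on a component with $F'$, which [extension_near] bounds. *)
Lemma totally_unbounded_non_extendable f :
  totally_unbounded Omega (derive1 f) -> ~ extendable Omega f.
Proof.
move=> TU [U [F [Y [dU bU hF cY fF]]]].
have [eta [r [M [[r0 nO] sub near bF bF']]]] := extension_near _ _ _ dU bU hF cY.
case: cY near fF => x Dx -> near fF.
have r20 : 0 < r / 2 by rewrite divr_gt0.
have [y Yy hy] := near _ r20.
have Oy := (component_sub _ _ _ Yy).2.
have By : (ball eta (r / 2)%:C `&` Omega) y by split => //; rewrite ball_normcE.
apply: (TU eta (r / 2) (edge_point_boundary _ _ _ _ oO nO near) r20 _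
  (ex_intro2 _ _ y By erefl)).
apply/bounded_normcP; exists (16 * M / (r / 8)) => z Yz.
have [Bz Oz] := component_sub _ _ _ Yz.
suff -> : derive1 f z = derive1 F z by exact: bF'.
have oY : open (connected_component (U `&` Omega) x).
  by apply: open_component; apply: openI => //; case: dU.
have Yz' : connected_component (U `&` Omega) x z.
  apply: (component_extend _ _ _ (@component_connected _ _ y)) Yz.
    move=> w /component_sub[]; rewrite ball_normcE => hw Ow; split => //.
    by apply: sub; rewrite ball_normcE; apply: lt_trans hw _; lra.
  by exists y => //; exact: component_mem.
have [d d0 hd] := (open_normcP _).1 oY z Yz'.
have : is_cderive F z (derive1 f z).
  by apply: is_cderive_near_eq d0 _ (X_cderive f z Oz) => w /hd /fF.
by move=> /is_cderiveE[_ ->].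
Qed.

(** Admissibility is a conjunct, so that an inadmissible triple gives the empty set, whose
    complement is the whole space. The bound [n] supplies the compactness behind closedness. *)
Definition bounded_extension j (n : nat) : set (X Omega V K) :=
  [set f : X Omega V K | rat_adm Omega j /\ exists F : R[i]^o -> R[i]^o,
    [/\ holomorphic_on (rat_disk j) F,
        forall z, rat_disk j z -> normc (F z) <= n%:R &
        forall z, rat_comp Omega j z -> f z = F z]].

(** Shrinking to a rational disk near an edge point makes the extension bounded; conversely an
    admissible rational disk is itself a domain meeting the boundary. *)
Lemma extendableE f : extendable Omega f <-> exists j n, bounded_extension j n f.
Proof.
split.
  move=> [U [F [Y [dU bU hF cY fF]]]].
  have [eta [r [M [[r0 nO] sub near bF _]]]] := extension_near _ _ _ dU bU hF cY.
  case: cY near fF => x Dx -> near fF.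
  have oU : open U by case: dU.
  have [j [adm subj subY]] := rat_comp_exists _ _ x eta r oO r0 sub nO near oU.
  exists j, (Num.bound `|M|); split => //; exists F; split.
  - by move=> z /subj /sub; exact: hF.
  - move=> z /subj /bF h; apply: le_trans h _; apply: le_trans (ler_norm M) _.
    by apply: ltW; exact: archi_boundP.
  by move=> z /subY /fF.
move=> [j [n [adm [F [hF _ fF]]]]].
have [eta [Deta nO near]] := rat_disk_edge _ _ oO adm.
have [Op r0 _] := adm.
have Dp : rat_disk j (rat_point j.1 : R[i]^o).
  by rewrite /rat_disk ball_normcE subrr normc0.
exists (rat_disk j), F, (rat_comp Omega j); split => //.
- split; [exact: open_ballc|by exists (rat_point j.1)|exact: ball_connected].
- exists eta; split => //; exact: edge_point_boundary nO near.
- by exists (rat_point j.1).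
Qed.

(** If $g_k\to f$ and each $g_k$ has an extension $F_k$ bounded by [n], an ultralimit of the $F_k$
    is holomorphic on the disk with the same bound, and it agrees with [f] on the component because
    $F_k=g_k$ there. *)
Lemma bounded_extension_closed j n : open (~` bounded_extension j n).
Proof.
apply/(X_open_cyl exK) => f nf; apply: contrapT => none; apply: nf.
(* The index [k] controls both the compact set and the precision, so one sequence converges to
   [f]. *)
have hex k : exists g : X Omega V K,
    X_cyl f k k.+1%:R^-1 g /\ bounded_extension j n g.
  apply: contrapT => h'; apply: none.
  exists k; exists k.+1%:R^-1; first by rewrite invr_gt0 ltr0n.
  by move=> g hg hj; apply: h'; exists g.
have [h hh] := choice hex.
have adm : rat_adm Omega j by case: (hh 0%N) => _ [].
split => //.
have Fex k : exists F : R[i]^o -> R[i]^o,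
    [/\ holomorphic_on (rat_disk j) F,
        forall z, rat_disk j z -> normc (F z) <= n%:R &
        forall z, rat_comp Omega j z -> h k z = F z].
  by case: (hh k) => _ [_].
have [F hF] := choice Fex.
have [U [UF sU]] := ultraFilterLemma (eventually_filter : ProperFilter \oo).
have evU N (P : nat -> Prop) : (forall l, (N <= l)%N -> P l) -> U [set l | P l].
  by move=> hP; apply: sU; exists N => // l /= /hP.
have lim z : exists l : R[i], rat_disk j z ->
    forall e : R, 0 < e -> U [set k | normc (F k z - l) < e].
  have [Dz|nDz] := pselect (rat_disk j z); last by exists 0.
  have [|l hl] := @ultra_lim R nat U UF (fun k => F k z) n%:R.
    by apply: (evU 0%N) => l _; case: (hF l) => _ /(_ z Dz).
  by exists l.
have [G hG] := choice lim.
exists G; split.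
- apply/holomorphic_cderive => a Da.
  have [r r0 hr] := (open_normcP _).1 (open_ballc _ _) a Da.
  have r4 : 4 * (r / 4) = r by rewrite mulrC divfK.
  apply: (@ultra_lim_cderive R nat U UF F G a (r / 4) n%:R).
  + by rewrite divr_gt0.
  + apply: (evU 0%N) => l _ w; rewrite r4 => /hr Dw.
    have [h1 h2 _] := hF l; split; last exact: h2.
    exact: ((holomorphic_cderive _ _).1 h1 w Dw).
  by move=> w; rewrite r4 => /hr Dw; exact: hG.
- move=> z Dz; rewrite -[G z]subr0.
  apply: (@ultra_lim_le R nat U UF (fun k => F k z)); first exact: hG.
  by apply: (evU 0%N) => l _; case: (hF l) => _ /(_ z Dz); rewrite subr0.
move=> z Yz; have [Dz Oz] := component_sub _ _ _ Yz.
have [m Kz] := X_cover exK z Oz.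
apply/esym/eqP; rewrite -subr_eq0; apply/eqP; apply: eq0_normc; apply/eqP.
rewrite eq_le normc_ge0 andbT; apply/ler_addgt0Pr => e e0; rewrite add0r.
apply: (@ultra_lim_le R nat U UF (fun k => F k z)); first exact: hG.
(* From [m] on the compact sets contain [z]; beyond the bound of [e^-1] the precision is at most
   [e]. *)
apply: (evU (maxn m (Num.bound e^-1))) => l; rewrite geq_max => /andP[ml el].
have [hl _] := hh l; have [_ _ <- //] := hF l.
apply: le_trans (hl z _) _.
  by right; exact: (exhaustion_mono _ _ _ _ exK ml).
rewrite -[e]invrK lef_pV2 ?posrE ?invr_gt0 ?ltr0n //.
apply: ltW; apply: lt_le_trans (archi_boundP _) _; first by rewrite invr_ge0 ltW.
by rewrite ler_nat; apply: leq_trans el _.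
Qed.

(** Reindexes by natural numbers, the form taken by [X_baire] and [Gdelta]. Codes of no pair give
    the whole space, which is open and dense. *)
Definition countable_family (A : rat * rat * rat -> nat -> set (X Omega V K)) k :=
  if unpickle k is Some (j, n) then A j n else setT.

Lemma countable_familyE A :
  \bigcap_k countable_family A k = [set f : X Omega V K | forall j n, A j n f].
Proof.
apply/seteqP; split => f.
  move=> hf j n; have := hf (pickle (j, n)) I.
  by rewrite /countable_family pickleK.
by move=> hf k _; rewrite /countable_family; case: unpickle => [[j n]|].
Qed.

Lemma countable_familyP (P : set (X Omega V K) -> Prop) A : P setT ->
  (forall j n, P (A j n)) -> forall k, P (countable_family A k).
Proof. by move=> P0 hA k; rewrite /countable_family; case: unpickle => [[j n]|]. Qed.

End generic_functions.

Arguments large_derivative {R Omega V K}.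
Arguments bounded_extension {R Omega V K}.
Arguments countable_family {R Omega V K}.
Arguments totally_unboundedE {R Omega V K}.
Arguments extendableE {R Omega V K}.

(** * Density and $G_\delta$ property of the two sets *)

Theorem theorem3p1 (R : realType) (Omega V : set R[i]^o)
    (K : (set R[i]^o)^nat) :
  domain Omega -> open V -> V `<=` Omega -> exhaustion Omega K ->
  (forall alpha : R[i]^o, (closure V `&` boundary Omega) alpha ->
    exists beta : R[i]^o, [/\ (~` Omega) beta, beta <> alpha
                   & segment alpha beta `<=` ~` Omega]) ->
  let TU := [set f : X Omega V K | totally_unbounded Omega (derive1 f)] in
  let NE := [set f : X Omega V K | ~ extendable Omega f] in
  (dense TU /\ Gdelta TU) /\ (Gdelta NE /\ dense NE).
Proof.
move=> [oO _ _] _ VO exK seg TU NE.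
have wit z : boundary Omega z -> exists f : X Omega V K, blows_up Omega (derive1 f) z.
  move=> bz; have [nO _] := (boundaryP _ _ oO).1 bz.
  have [cz|ncz] := pselect (closure V z); last exact: witness_off_closure.
  have [b [nb ba hb]] := seg z (conj cz bz).
  exact: (witness_segment _ _ _ _ _ oO VO nO nb ba hb).
have TUE : TU = \bigcap_k countable_family large_derivative k.
  by rewrite countable_familyE; apply/seteqP; split => f /(totally_unboundedE oO).
have NEE : NE = \bigcap_k countable_family
    (fun j n => ~` bounded_extension j n) k.
  rewrite countable_familyE; apply/seteqP; split => f.
    by move=> nf j n hf; apply: nf; apply/(extendableE oO); exists j, n.
  by move=> hf /(extendableE oO)[j [n]]; exact: hf.
have dTU : dense TU.
  rewrite TUE; apply: (X_baire VO exK) => k.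
    by apply: countable_familyP => [|j n]; [exact: openT|exact: large_derivative_open].
  apply: countable_familyP => [|j n]; last exact: large_derivative_dense.
  by move=> O [f Of] _; exists f.
split; split => //.
- exists (countable_family large_derivative) => // k.
  by apply: countable_familyP => [|j n]; [exact: openT|exact: large_derivative_open].
- exists (countable_family (fun j n => ~` bounded_extension j n)) => // k.
  by apply: countable_familyP => [|j n]; [exact: openT|exact: bounded_extension_closed].
(* Density passes from the first set to the second, which contains it. *)
move=> O O0 oO'; have [f [Of TUf]] := dTU O O0 oO'.
by exists f; split => //; exact: totally_unbounded_non_extendable TUf.
Qed.
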